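(* Suppose each $f_i$ is $v_i$-strongly convex with $\ell_i$-Lipschitz gradient, and $\mathcal G$ is undirected and connected with $\mathbf L_{\mathsf u}$ positive definite. Let $\mathcal C$ be a $\delta$-contractive compressor. Suppose that $c>0$, $\delta\in[0,1)$ and a real number $\beta>\frac{\ell^2}{2c\lambda_2 v}$ satisfy $G(\beta)>0$ and $$\frac{\delta}{(1-\sqrt{\delta})^2}<\frac{G(\beta)}{3c\lambda_n+2c\beta\lambda_n+\frac{c\lambda_n^2}{\beta\lambda_2}},$$ where $$G(\beta)=\frac{c\hat\lambda_1}{2}-\frac{2c\beta\lambda_2\ell^2}{2c\beta\lambda_2 v-\ell^2}-\frac{c^2\hat\lambda_n^2+4\ell^2}{c\beta\lambda_2}.$$ Then there is $\sigma\in(0,1)$, which is a linear rate of CC-DQM without event-triggering (i.e. CC-DQM run with $\mu_k=0$ for all $k$ satisfies $\|\mathbb E(\tilde{\mathbf x}_k)-\tilde{\mathbf x}^*\|=\mathcal O(\sigma^k)$), such that for all $\alpha>0$ and $0<\rho<1$, CC-DQM run with thresholds $\mu_k=\alpha\rho^{k-1}$ satisfies $$\|\mathbb E(\tilde{\mathbf x}_k)-\tilde{\mathbf x}^*\|=\mathcal O(\tilde\sigma^k)\quad (k\to\infty),\qquad \tilde\sigma=\max(\sigma,\rho).$$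
   Context: **Problem.** $n$ agents solve $\min_{\mathbf x\in\mathbb R^d}\sum_{i=1}^n f_i(\mathbf x)$, with $f_i:\mathbb R^d\to\mathbb R$ twice differentiable. The function $f_i$ is $v_i$-strongly convex ($v_i>0$) if $\langle\nabla f_i(x')-\nabla f_i(x),x'-x\rangle\ge v_i\|x'-x\|^2$ for all $x,x'$, and its gradient is $\ell_i$-Lipschitz if $\|\nabla f_i(x')-\nabla f_i(x)\|\le\ell_i\|x'-x\|$ for all $x,x'$. Set $v=\min_i v_i$, $\ell=\max_i\ell_i$. $\mathbf x^*$ denotes the (unique) minimizer of the problem, and $\tilde{\mathbf x}^*=[\mathbf x^*,\dots,\mathbf x^*]\in\mathbb R^{nd}$ is the stack of $n$ copies of it. $\|\cdot\|$ is the Euclidean norm. **Graph.** $\mathcal G=(\mathcal V,\mathcal E)$, $\mathcal V=\{1,\dots,n\}$, $\mathcal E\subset\mathcal V\times\mathcal V$, without self-loops; $\mathcal N_i=\{j:(j,i)\in\mathcal E\}$, $d_i=|\mathcal N_i|$, $\mathbf D=\mathrm{diag}(d_1,\dots,d_n)$, $\mathbf W$ is the adjacency matrix ($w_{ij}=1$ if $(j,i)\in\mathcal E$, else $0$). $\mathbf L=\mathbf D-\mathbf W$ has eigenvalues $\lambda_1\le\dots\le\lambda_n$ and $\mathbf L_{\mathsf u}=\mathbf D+\mathbf W$ has eigenvalues $\hat\lambda_1\le\dots\le\hat\lambda_n$. **Compressor.** A (possibly randomized) map $\mathcal C:\mathbb R^d\to\mathbb R^d$ is a $\delta$-contractive compressor,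 $0\le\delta<1$, if $\mathbb E\|\mathbf x-\mathcal C(\mathbf x)\|^2\le\delta\|\mathbf x\|^2$ for all $\mathbf x\in\mathbb R^d$. Each call of $\mathcal C$ uses fresh randomness independent of the past; $\mathbb E$ is expectation over this randomness. **Algorithm CC-DQM.** Parameters: penalty $c>0$, thresholds $\mu_k\ge0$. Initialize with arbitrary $\mathbf x_{i,0}\in\mathbb R^d$, $\boldsymbol\phi_{i,0}=\mathbf 0$, $\mathbf y_{i,0}=\mathbf 0$. For $k=0,1,2,\dots$, every agent $i$ computes $$\mathbf x_{i,k+1}=\mathbf x_{i,k}-\big(2cd_i\mathbf I+\nabla^2 f_i(\mathbf y_{i,k})\big)^{-1}\Big(\nabla f_i(\mathbf x_{i,k})+c\sum_{j\in\mathcal N_i}(\mathbf y_{i,k}-\mathbf y_{j,k})+\boldsymbol\phi_{i,k}\Big);$$ if $\|\mathbf x_{i,k+1}-\mathbf y_{i,k}\|\ge\mu_k$ then $\mathbf y_{i,k+1}=\mathbf y_{i,k}+\mathcal C(\mathbf x_{i,k+1}-\mathbf y_{i,k})$ (the same realization of $\mathcal C$ is sent to the neighbors), otherwise $\mathbf y_{i,k+1}=\mathbf y_{i,k}$; finally $$\boldsymbol\phi_{i,k+1}=\boldsymbol\phi_{i,k}+c\sum_{j\in\mathcal N_i}(\mathbf y_{i,k+1}-\mathbf y_{j,k+1}).$$ $\tilde{\mathbf x}_k=[\mathbf x_{1,k},\dots,\mathbf x_{n,k}]\in\mathbb R^{nd}$ is the stacked iterate. *)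

(* Defs.v *)
From HB Require Import structures.
From mathcomp Require Import all_boot all_order all_algebra.
From mathcomp Require Import all_classical all_reals all_analysis.

Set Implicit Arguments.
Unset Strict Implicit.
Unset Printing Implicit Defensive.

Import Order.TTheory GRing.Theory Num.Theory.
Import numFieldNormedType.Exports.

Local Open Scope classical_set_scope.
Local Open Scope ring_scope.

Section Euclidean.
Variable R : realType.

Definition dotv (m : nat) (x y : 'cV[R]_m) : R := \sum_(a < m) x a 0 * y a 0.

(* The library norm [`|x|] on matrices is the max norm; it is only used through
   the topology, which is the Euclidean one. *)
Definition enorm (m : nat) (x : 'cV[R]_m) : R := Num.sqrt (dotv x x).

Definition grad (d : nat) (f : 'cV[R]_d -> R) (x : 'cV[R]_d) : 'cV[R]_d :=
  \col_(a < d) 'D_(delta_mx a 0) f x.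

Definition hess (d : nat) (f : 'cV[R]_d -> R) (x : 'cV[R]_d) : 'M[R]_d :=
  \matrix_(a < d, b < d) 'D_(delta_mx b 0) (fun z => grad f z a 0) x.

Definition twice_differentiable (d : nat) (f : 'cV[R]_d -> R) : Prop :=
  (forall x, differentiable f x) /\ (forall x, differentiable (grad f) x).

Definition strongly_convex (d : nat) (v : R) (f : 'cV[R]_d -> R) : Prop :=
  forall x x', v * enorm (x' - x) ^+ 2 <= dotv (grad f x' - grad f x) (x' - x).

Definition lipschitz_grad (d : nat) (l : R) (f : 'cV[R]_d -> R) : Prop :=
  forall x x', enorm (grad f x' - grad f x) <= l * enorm (x' - x).

Definition is_minimizer (d : nat) (g : 'cV[R]_d -> R) (x : 'cV[R]_d) : Prop :=
  forall z, g x <= g z.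

(* Families indexed by ['I_n.+1] are nonempty, so that seeding the iterated
   min/max with the entry of index 0 gives the true minimum/maximum. *)
Definition minI (n : nat) (v : 'I_n.+1 -> R) : R :=
  \big[Num.min/v ord0]_(i < n.+1) v i.

Definition maxI (n : nat) (l : 'I_n.+1 -> R) : R :=
  \big[Num.max/l ord0]_(i < n.+1) l i.

(* [lam] lists the eigenvalues of [A], with multiplicity, in nondecreasing
   order; when [A] is symmetric such a [lam] exists and is unique. *)
Definition ordered_eigenvalues (n : nat) (A : 'M[R]_n) (lam : n.-tuple R) :
    Prop :=
  sorted <=%R lam /\ char_poly A = \prod_(a <- lam) ('X - a%:P).

Definition posdef (n : nat) (A : 'M[R]_n) : Prop :=
  A^T = A /\ forall x : 'cV[R]_n, x != 0 -> 0 < dotv x (A *m x).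

End Euclidean.

(* An edge set is a relation [E] on the vertices: [E j i] means (j, i) is an
   edge. *)
Section Graph.
Variables (n : nat) (E : rel 'I_n).

Definition nbr (i : 'I_n) : {set 'I_n} := [set j | E j i]%SET.

Definition deg (i : 'I_n) : nat := #|nbr i|.

Definition connected_graph : Prop := forall i j, connect E i j.

Definition degmx (R : realType) : 'M[R]_n := diag_mx (\row_(i < n) (deg i)%:R).

Definition adjmx (R : realType) : 'M[R]_n := \matrix_(i, j) (E j i)%:R.

Definition laplacian (R : realType) : 'M[R]_n := degmx R - adjmx R.

Definition unsigned_laplacian (R : realType) : 'M[R]_n := degmx R + adjmx R.

End Graph.

(* A randomized map is a function [C s x] of the input [x] and of a seed [s] with
   law [Q]. *)
Section Compressor.
Variables (R : realType) (d : nat).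

Definition borel_vec := g_sigma_algebraType (@open 'cV[R]_d).

Definition jointly_measurable (dS : measure_display) (S : measurableType dS)
    (C : S -> 'cV[R]_d -> 'cV[R]_d) : Prop :=
  measurable_fun [set: (S * borel_vec)%type]
    (fun p : S * borel_vec => C p.1 p.2 : borel_vec).

Definition contractive_compressor (dS : measure_display)
    (S : measurableType dS) (Q : probability S R) (delta : R)
    (C : S -> 'cV[R]_d -> 'cV[R]_d) : Prop :=
  jointly_measurable C /\
  forall x : 'cV[R]_d,
    ('E_Q[fun s => (enorm (x - C s x) ^+ 2)%R] <=
       (delta * enorm x ^+ 2)%:E)%E.

End Compressor.

Section FreshSeeds.
Variables (R : realType) (n : nat).
Variables (dS : measure_display) (S : measurableType dS) (Q : probability S R).
Variables (dT : measure_display) (T : measurableType dT) (P : probability T R).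
Variable xi : 'I_n -> nat -> T -> S.

Definition past (k : nat) : set (set T) :=
  <<s [set B | exists (j : 'I_n) (m : nat) (A : set S),
         [/\ (m < k)%N, measurable A & B = xi j m @^-1` A] ] >>.

(* Seeds used by different agents in the same iteration may be dependent. *)
Definition fresh_seeds : Prop :=
  [/\ forall i k, measurable_fun setT (xi i k),
      forall i k (A : set S), measurable A -> P (xi i k @^-1` A) = Q A
    & forall i k (A : set S) (B : set T), measurable A -> past k B ->
        P (xi i k @^-1` A `&` B) = (P (xi i k @^-1` A) * P B)%E].

End FreshSeeds.

Section Algorithm.
Variables (R : realType) (n d : nat).

Record state := State {
  x_ : 'I_n -> 'cV[R]_d;
  y_ : 'I_n -> 'cV[R]_d;
  phi_ : 'I_n -> 'cV[R]_d }.

Variables (E : rel 'I_n) (f : 'I_n -> 'cV[R]_d -> R) (S : Type).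
Variables (C : S -> 'cV[R]_d -> 'cV[R]_d) (c : R) (mu : nat -> R).

Definition ccdqm_step (k : nat) (s : 'I_n -> S) (st : state) : state :=
  let: State x y phi := st in
  let x' i :=
    x i - invmx ((2 * c * (deg E i)%:R)%:M + hess (f i) (y i)) *m
          (grad (f i) (x i) + c *: (\sum_(j in nbr E i) (y i - y j)) + phi i) in
  let y' i :=
    if mu k <= enorm (x' i - y i) then y i + C (s i) (x' i - y i) else y i in
  let phi' i := phi i + c *: (\sum_(j in nbr E i) (y' i - y' j)) in
  State x' y' phi'.

(* [s i k] is the seed of the compression made by agent [i] at iteration [k]. *)
Fixpoint ccdqm (x0 : 'I_n -> 'cV[R]_d) (s : 'I_n -> nat -> S) (k : nat) :
    state :=
  if k is k'.+1 then ccdqm_step k' (fun i => s i k') (ccdqm x0 s k')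
  else State x0 (fun=> 0) (fun=> 0).

End Algorithm.

Section Rate.
Variable R : realType.

Definition stack (n d : nat) (x : 'I_n -> 'cV[R]_d) :
    'cV[R]_(\sum_(i < n) d) := \mxcol_(i < n) x i.

Section RandomVector.
Variables (dT : measure_display) (T : measurableType dT) (P : probability T R).
Variables (m : nat) (X : T -> 'cV[R]_m).

Definition vec_integrable : Prop :=
  forall a : 'I_m, P.-integrable setT (EFin \o (fun w => X w a 0)).

(* Meaningful when [vec_integrable] holds. *)
Definition vec_expectation : 'cV[R]_m :=
  \col_(a < m) fine 'E_P[fun w => X w a 0].

End RandomVector.

(* The linear rate [sigma] is a property of the algorithm: it holds for all
   realizations of the seeds on a probability space and all initial points (only
   the constant hidden in the big O may depend on them). Integrability says that
   the expected iterates exist. *)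
Definition ccdqm_linear_rate (n d : nat) (E : rel 'I_n)
    (f : 'I_n -> 'cV[R]_d -> R) (xstar : 'cV[R]_d)
    (dS : measure_display) (S : measurableType dS) (Q : probability S R)
    (C : S -> 'cV[R]_d -> 'cV[R]_d) (c : R) (mu : nat -> R) (sigma : R) : Prop :=
  forall (dT : measure_display) (T : measurableType dT) (P : probability T R)
    (xi : 'I_n -> nat -> T -> S) (x0 : 'I_n -> 'cV[R]_d),
  fresh_seeds Q P xi ->
  let X k (w : T) :=
    stack (x_ (ccdqm E f C c mu x0 (fun i k => xi i k w) k)) in
  (forall k, vec_integrable P (X k)) /\
  (fun k : nat => enorm (vec_expectation P (X k) - stack (fun=> xstar)))
    =O_\oo (fun k : nat => sigma ^+ k).

(* [hlam1], [hlamn] are the extreme eigenvalues of the unsigned Laplacian. *)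
Definition Gfun (c v l lam2 hlam1 hlamn beta : R) : R :=
  c * hlam1 / 2
  - 2 * c * beta * lam2 * l ^+ 2 / (2 * c * beta * lam2 * v - l ^+ 2)
  - (c ^+ 2 * hlamn ^+ 2 + 4 * l ^+ 2) / (c * beta * lam2).

End Rate.

(* Main.v *)
Require Import Defs.
From HB Require Import structures.
From mathcomp Require Import all_boot all_order all_algebra.
From mathcomp Require Import all_classical all_reals all_analysis.
From mathcomp Require Import measurable_realfun.
From mathcomp Require Import ring lra complex.

Set Implicit Arguments.
Unset Strict Implicit.
Unset Printing Implicit Defensive.

Import Order.TTheory GRing.Theory Num.Theory.
Import numFieldNormedType.Exports.

Local Open Scope classical_set_scope.
Local Open Scope ring_scope.

(** The proof is a Lyapunov argument in mean square.  Stack the agents as the rows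
of matrices; let z be the deviation of x from xstar, D the step of x, e = x - y
the compression error, and let psi represent the dual deviation phi + grad f(xstar)
through L psi = phi + grad f(xstar), which is possible because the columns of the
dual deviation have zero sum and the kernel of the Laplacian L of a connected
graph consists of the constants ([range_pinv], [laplacian_dual_dev]).  Since
2 deg = L + Lu, the update of x reads ([optimality_eq])

  g + r + c Lu D - c L (e_old - e_new) + L psi_new = 0,

where g is the deviation of the gradients, and the Newton residual r satisfies
|r| <= 2 l |D|, because gradient and Hessian are both controlled by l.

Energy.  For V = c/2 <z, Lu z> + 1/(2c) <psi, L psi>, pairing this identity with
z_new gives, up to Young inequalities ([lyapunov_step]),

  (1 + eps) V_new + G' |D|^2 <= V_old + a |e_old|^2 + b |e_new|^2.

Strong convexity pays for the terms in |z|^2.  The cross term <L psi, e> costs a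
multiple of |L psi|^2 (the spectral gap lam2 bounds <psi, L psi> by |L psi|^2 / lam2),
and the identity expresses L psi through g, r, D and e again.  At eps = 0 the
coefficient G' is the function G of the statement, and a + b is below the
denominator of the smallness condition on delta.

Compression.  With q = sqrt delta, contractivity and a convexity inequality give
E|e_new|^2 <= q E|e_old|^2 + delta / (1 - q) E|D|^2 + (number of agents) mu_k^2
([compression_recursion]).  The expectation is legitimate because the point to be
compressed is measurable with respect to the past seeds, of which the new seed is
independent: their joint law is a product, and Fubini-Tonelli applies
([independent_integral], [fresh_error_bound]).  The same bound propagates square
integrability along the iteration ([run_L2]).

Conclusion.  Summing the geometric series of factor q turns delta / (1 - q) into
delta / (1 - q)^2, so the condition on delta is what makes E V + theta E|e|^2
contract by the factor 1 / (1 + eps), up to a multiple of mu_k^2; the strictness of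
the condition leaves room for some eps > 0 ([parameter_choice],
[lyapunov_recursion]).  The rate sigma is chosen with sigma^2 strictly above
1 / (1 + eps), so that a forcing of order tau^(2k) with tau >= sigma yields the decay
tau^(2k) even when tau = sigma, without a polynomial factor ([geometric_recursion]).
Jensen's inequality passes from E|x - xstar|^2 to the expected iterate
([expectation_error]). *)

(** * Frobenius inner product *)

Section InnerProduct.
Variable R : realFieldType.

Definition ip (m p : nat) (A B : 'M[R]_(m, p)) : R := \tr (A^T *m B).

Section Bilinear.
Variables (m p : nat).
Implicit Types A B D : 'M[R]_(m, p).

Lemma ipC A B : ip A B = ip B A.
Proof. by rewrite /ip -mxtrace_tr trmx_mul trmxK. Qed.

Lemma ipDl A B D : ip (A + B) D = ip A D + ip B D.
Proof. by rewrite /ip linearD mulmxDl mxtraceD. Qed.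

Lemma ipZl a A D : ip (a *: A) D = a * ip A D.
Proof. by rewrite /ip linearZ -scalemxAl mxtraceZ. Qed.

Lemma ipNl A D : ip (- A) D = - ip A D.
Proof. by rewrite -scaleN1r ipZl mulN1r. Qed.

Lemma ipBl A B D : ip (A - B) D = ip A D - ip B D.
Proof. by rewrite ipDl ipNl. Qed.

Lemma ipDr A B D : ip D (A + B) = ip D A + ip D B.
Proof. by rewrite ipC ipDl !(ipC D). Qed.

Lemma ipZr a A D : ip D (a *: A) = a * ip D A.
Proof. by rewrite ipC ipZl ipC. Qed.

Lemma ipNr A D : ip D (- A) = - ip D A.
Proof. by rewrite ipC ipNl ipC. Qed.

Lemma ipBr A B D : ip D (A - B) = ip D A - ip D B.
Proof. by rewrite ipDr ipNr. Qed.

Lemma ip0l D : ip 0 D = 0.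
Proof. by rewrite -(scale0r D) ipZl mul0r. Qed.

Lemma ipE A B : ip A B = \sum_i \sum_j A i j * B i j.
Proof.
rewrite exchange_big; apply: eq_bigr => j _ /=.
by rewrite mxE; apply: eq_bigr => i _; rewrite mxE.
Qed.

Lemma ip_ge0 A : 0 <= ip A A.
Proof.
by rewrite ipE; apply: sumr_ge0 => i _; apply: sumr_ge0 => j _; exact: sqr_ge0.
Qed.

Lemma ip_eq0 A : (ip A A == 0) = (A == 0).
Proof.
apply/idP/eqP => [|->]; last by rewrite ip0l.
rewrite ipE psumr_eq0 => [/allP h|i _]; last first.
  by apply: sumr_ge0 => j _; exact: sqr_ge0.
apply/matrixP => i j; rewrite mxE.
have /implyP/(_ isT) := h i (mem_index_enum _).
rewrite psumr_eq0 => [/allP h' | k _]; last exact: sqr_ge0.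
by have /implyP/(_ isT) := h' j (mem_index_enum _); rewrite mulf_eq0 orbb => /eqP.
Qed.

Lemma ip_gt0 A : A != 0 -> 0 < ip A A.
Proof. by move=> A0; rewrite lt_def ip_ge0 ip_eq0 A0. Qed.

Lemma ip_adj (M : 'M[R]_m) A B : M^T = M -> ip (M *m A) B = ip A (M *m B).
Proof. by move=> sM; rewrite /ip trmx_mul sM mulmxA. Qed.

End Bilinear.
End InnerProduct.

Definition ip_expand := (ipDl, ipBl, ipNl, ipZl, ipDr, ipBr, ipNr, ipZr).

(** * Energy decrease along one step *)

Section Step.
Variables (R : realFieldType) (N d : nat) (L Lu : 'M[R]_N).
Hypotheses (sL : L^T = L) (sLu : Lu^T = Lu).
Variables (c beta v l lam2 lamn hlam1 hlamn : R).
Hypotheses (c_gt0 : 0 < c) (beta_gt0 : 0 < beta) (lam2_gt0 : 0 < lam2).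
Local Notation "A <*> B" := (@ip R N d A B) (at level 40).
Hypothesis L_psd : forall X : 'M[R]_(N, d), 0 <= X <*> (L *m X).
Hypothesis L_up : forall X : 'M[R]_(N, d), X <*> (L *m X) <= lamn * (X <*> X).
Hypothesis L_sq : forall X : 'M[R]_(N, d),
  (L *m X) <*> (L *m X) <= lamn ^+ 2 * (X <*> X).
Hypothesis L_gap : forall X : 'M[R]_(N, d),
  lam2 * (X <*> (L *m X)) <= (L *m X) <*> (L *m X).
Hypothesis Lu_low : forall X : 'M[R]_(N, d), hlam1 * (X <*> X) <= X <*> (Lu *m X).
Hypothesis Lu_up : forall X : 'M[R]_(N, d), X <*> (Lu *m X) <= hlamn * (X <*> X).
Hypothesis Lu_sq : forall X : 'M[R]_(N, d),
  (Lu *m X) <*> (Lu *m X) <= hlamn ^+ 2 * (X <*> X).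

(** The dual part is the squared norm of the dual deviation L psi for the
    pseudo-inverse of L, written with a preimage psi. *)
Definition energy (z psi : 'M[R]_(N, d)) : R :=
  c / 2 * (z <*> (Lu *m z)) + (2 * c)^-1 * (psi <*> (L *m psi)).

Variables (z0 z e0 e1 psi0 psi1 g r : 'M[R]_(N, d)).
Hypothesis opt : g + r + c *: (Lu *m (z - z0)) - c *: (L *m (e0 - e1))
  + L *m psi1 = 0.
Hypothesis dual : L *m psi1 = L *m psi0 + c *: (L *m (z - e1)).
Hypothesis g_mono : v * (z <*> z) <= g <*> z.
Hypothesis g_lip : g <*> g <= l ^+ 2 * (z <*> z).
Hypothesis r_bnd : r <*> r <= 4 * l ^+ 2 * ((z - z0) <*> (z - z0)).

(** Pair [opt] with z.  The term in [Lu] telescopes by polarization, and so does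
    the dual term, because [dual] makes psi1 - psi0 and c (z - e1) indistinguishable
    by L; the polarization remainder of the latter is the negative term in z - e1. *)
Lemma energy_eq : energy z psi1 - energy z0 psi0 =
  - (g <*> z) - (r <*> z) - c / 2 * ((z - z0) <*> (Lu *m (z - z0)))
  + c * ((L *m (e0 - e1)) <*> z) - c / 2 * ((z - e1) <*> (L *m (z - e1)))
  - ((L *m psi1) <*> e1).
Proof.
have c0 : c != 0 by rewrite gt_eqF.
have E1 : (L *m psi1) <*> z = - (g <*> z) - (r <*> z)
    - c * ((Lu *m (z - z0)) <*> z) + c * ((L *m (e0 - e1)) <*> z).
  have /eqP := opt; rewrite addrC addr_eq0 => /eqP ->.
  by rewrite !ip_expand; ring.
have E2 (X : 'M[R]_(N, d)) : (L *m psi1) <*> X = (L *m psi0) <*> X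
    + c * ((L *m (z - e1)) <*> X) by rewrite dual !ip_expand.
have E3 : psi1 <*> (L *m psi1) - psi0 <*> (L *m psi0) =
   2 * c * ((L *m psi1) <*> (z - e1)) - c ^+ 2 * ((z - e1) <*> (L *m (z - e1))).
  move: dual E2; set w := z - e1 => dual' E2.
  have k1 : psi1 <*> (L *m psi1) = (L *m psi0) <*> psi1 + c * ((L *m w) <*> psi1).
    by rewrite -(ip_adj psi1 psi1 sL) E2.
  have k2 : (L *m psi0) <*> psi1 = psi0 <*> (L *m psi0) + c * (psi0 <*> (L *m w)).
    by rewrite (ip_adj psi0 psi1 sL) dual' ipDr ipZr.
  have k3 : psi0 <*> (L *m w) = (L *m psi1) <*> w - c * (w <*> (L *m w)).
    by rewrite -(ip_adj psi0 w sL) (E2 w) (ipC (L *m w) w) addrK.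
  have k4 : (L *m w) <*> psi1 = (L *m psi1) <*> w.
    by rewrite (ip_adj w psi1 sL) ipC.
  by rewrite k1 k2 k3 k4; ring.
have E4 : z <*> (Lu *m z) - z0 <*> (Lu *m z0) =
   2 * ((Lu *m (z - z0)) <*> z) - (z - z0) <*> (Lu *m (z - z0)).
  rewrite !mulmxBr !ip_expand (ip_adj z z sLu) (ip_adj z0 z sLu).
  by rewrite -(ip_adj z z0 sLu) (ipC (Lu *m z) z0); ring.
rewrite /energy.
transitivity (c / 2 * (z <*> (Lu *m z) - z0 <*> (Lu *m z0))
   + (2 * c)^-1 * (psi1 <*> (L *m psi1) - psi0 <*> (L *m psi0))); first by ring.
rewrite E3 E4 ipBr E1; field; exact: c0.
Qed.

(** Convexity of the square with the weights 1/2, 1/4, 1/8, 1/8, which sum to one.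
    They reproduce the coefficients of G and of the condition on delta. *)
Lemma ip_sum4 (t a b w : 'M[R]_(N, d)) :
  (t - a - b - w) <*> (t - a - b - w) <=
  2 * (t <*> t) + 4 * (a <*> a) + 8 * (b <*> b) + 8 * (w <*> w).
Proof.
have k1 := ip_ge0 (t + 2 *: a); have k2 := ip_ge0 (t + 4 *: b).
have k3 := ip_ge0 (t + 4 *: w); have k4 := ip_ge0 (a - 2 *: b).
have k5 := ip_ge0 (a - 2 *: w); have k6 := ip_ge0 (b - w).
move: k1 k2 k3 k4 k5 k6; rewrite !ip_expand.
rewrite (ipC a t) (ipC b t) (ipC w t) (ipC b a) (ipC w a) (ipC w b).
lra.
Qed.

(** Young inequalities bound the terms of [energy_eq] and the extra share
    eps * energy.  The product <L psi1, e1> and the share of the dual energy are paid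
    by chi |L psi1|^2, which [opt] turns into squares of g, r, the step and the errors.
    Strong convexity pays for all terms in |z|^2: [eta] is what is left of v for the
    Newton residual, after the gradient part of L psi1 and the share of the primal
    energy. *)
Lemma lyapunov_step (eps chi eta : R) : 0 <= eps -> 0 < eta ->
  chi = ((8 * c * beta)^-1 + eps / (2 * c)) / lam2 ->
  eta + 4 * chi * l ^+ 2 + eps * (c / 2) * hlamn = v ->
  (1 + eps) * energy z psi1
  + (c * hlam1 / 2 - l ^+ 2 / eta - 8 * chi * (4 * l ^+ 2 + c ^+ 2 * hlamn ^+ 2))
    * ((z - z0) <*> (z - z0)) <=
  energy z0 psi0 + (c * lamn / 2 + 4 * chi * c ^+ 2 * lamn ^+ 2) * (e0 <*> e0)
  + (2 * c * beta * lamn + 4 * chi * c ^+ 2 * lamn ^+ 2) * (e1 <*> e1).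
Proof.
move=> eps_ge0 eta_gt0 chiE etaE.
have chi_ge0 : 0 <= chi.
  rewrite chiE; apply: divr_ge0; last exact: ltW.
  by apply: addr_ge0; [rewrite invr_ge0 | apply: divr_ge0 => //];
    rewrite !mulr_ge0 // ltW.
have cn0 : c != 0 by rewrite gt_eqF.
have quadD (A B : 'M[R]_(N, d)) : (A + B) <*> (L *m (A + B)) =
    A <*> (L *m A) + 2 * ((L *m A) <*> B) + B <*> (L *m B).
  by rewrite !mulmxDr !ip_expand -(ip_adj A B sL) (ipC B (L *m A)); ring.
set Del := z - z0; set s := e0 - e1.
have rB : r <*> r <= 4 * l ^+ 2 * (Del <*> Del) by exact: r_bnd.
have F1 : - (r <*> z) <= eta * (z <*> z) + l ^+ 2 / eta * (Del <*> Del).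
  have h := ip_ge0 ((2 * eta) *: z + r); rewrite !ip_expand (ipC z r) in h.
  have h2 : 4 * eta * (- (r <*> z)) <= 4 * eta * (eta * (z <*> z) + l ^+ 2 / eta * (Del <*> Del)).
    have -> : 4 * eta * (eta * (z <*> z) + l ^+ 2 / eta * (Del <*> Del))
        = 4 * eta ^+ 2 * (z <*> z) + 4 * l ^+ 2 * (Del <*> Del).
      by field; rewrite gt_eqF.
    by lra.
  have e4 : 0 < 4 * eta by rewrite mulr_gt0.
  by rewrite -(ler_pM2l e4).
(* Completing the square in z - e1 leaves c/2 times the difference of the L-norms
   of e0 and e1. *)
have F2 : c * ((L *m s) <*> z) - c / 2 * ((z - e1) <*> (L *m (z - e1)))
   <= c * lamn / 2 * (e0 <*> e0).
  have h1 := L_psd (z - e1 - s); have h2 := L_psd e1; have h3 := L_up e0.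
  have -> : z = (z - e1) + e1 by rewrite subrK.
  have e0E : e0 = s + e1 by rewrite subrK.
  set w := z - e1 in h1 *; rewrite addrK.
  have h4 : e0 <*> (L *m e0) = s <*> (L *m s) + 2 * ((L *m s) <*> e1) + e1 <*> (L *m e1).
    by rewrite [in LHS]e0E quadD.
  have h5 : (w - s) <*> (L *m (w - s)) = w <*> (L *m w) - 2 * ((L *m s) <*> w) + s <*> (L *m s).
    by rewrite addrC quadD mulmxN ipNl ipNr ipNl; ring.
  rewrite h5 in h1; rewrite h4 in h3; rewrite ipDr.
  have h6 : c / 2 * 0 <= c / 2 * (w <*> (L *m w) - 2 * ((L *m s) <*> w) + s <*> (L *m s)).
    by rewrite ler_wpM2l // divr_ge0 // ltW.
  have h7 := ler_wpM2l (ltW c_gt0) h3.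
  have h8 : 0 <= c * (e1 <*> (L *m e1)) by rewrite mulr_ge0 // ltW.
  lra.
have F3 : - ((L *m psi1) <*> e1) <=
    (8 * c * beta)^-1 * (psi1 <*> (L *m psi1)) + 2 * c * beta * lamn * (e1 <*> e1).
  have h1 := L_psd (psi1 + (4 * c * beta) *: e1); have h3 := L_up e1.
  have cb : 0 < 8 * c * beta by rewrite !mulr_gt0.
  rewrite mulmxDr -scalemxAr !ip_expand -(ip_adj psi1 e1 sL) (ipC e1 (L *m psi1)) in h1.
  have h4 := ler_wpM2l (ltW cb) h3.
  have h4' : 2 * c * beta * (8 * c * beta * (e1 <*> (L *m e1))) <=
    2 * c * beta * (8 * c * beta * (lamn * (e1 <*> e1))).
    by rewrite ler_wpM2l // !mulr_ge0 // ltW.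
  rewrite -(ler_pM2l cb) mulrDr mulrA mulfV ?gt_eqF // mul1r.
  lra.
have F4 : (L *m psi1) <*> (L *m psi1) <= 4 * l ^+ 2 * (z <*> z)
   + 8 * (4 * l ^+ 2 + c ^+ 2 * hlamn ^+ 2) * (Del <*> Del)
   + 4 * c ^+ 2 * lamn ^+ 2 * (e0 <*> e0 + e1 <*> e1).
  set u := c *: (Lu *m Del); set t := c *: (L *m s).
  have psiE : L *m psi1 = t - g - r - u.
    have /eqP := opt; rewrite addrC addr_eq0 => /eqP ->.
    by rewrite -/u -/t !opprD opprK addrC !addrA.
  have G1 := ip_sum4 t g r u.
  have G2 : t <*> t <= 2 * c ^+ 2 * lamn ^+ 2 * (e0 <*> e0 + e1 <*> e1).
    have k1 : s <*> s <= 2 * (e0 <*> e0 + e1 <*> e1).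
      by have := ip_ge0 (e0 + e1); rewrite /s !ip_expand (ipC e1 e0); lra.
    have k2 := ler_wpM2l (sqr_ge0 c) (L_sq s).
    have k3 := ler_wpM2l (sqr_ge0 c) (ler_wpM2l (sqr_ge0 lamn) k1).
    rewrite /t ipZl ipZr; lra.
  have G3 : u <*> u <= c ^+ 2 * hlamn ^+ 2 * (Del <*> Del).
    have k2 := ler_wpM2l (sqr_ge0 c) (Lu_sq Del).
    rewrite /u ipZl ipZr; lra.
  have k7 := g_lip.
  rewrite psiE; lra.
have F5 : ((8 * c * beta)^-1 + eps / (2 * c)) * (psi1 <*> (L *m psi1)) <=
    chi * ((L *m psi1) <*> (L *m psi1)).
  have -> : ((8 * c * beta)^-1 + eps / (2 * c)) = chi * lam2.
    by rewrite chiE mulfVK // gt_eqF.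
  by rewrite -mulrA ler_wpM2l.
have F6 : eps * (c / 2) * (z <*> (Lu *m z)) <= eps * (c / 2) * (hlamn * (z <*> z)).
  by apply: ler_wpM2l => //; rewrite !mulr_ge0 // ltW.
have F7 := ler_wpM2l (ltW c_gt0) (Lu_low Del).
have F8 := ler_wpM2l chi_ge0 F4.
have vz : v * (z <*> z) = eta * (z <*> z) + 4 * chi * l ^+ 2 * (z <*> z)
  + eps * (c / 2) * hlamn * (z <*> z) by rewrite -etaE; ring.
have vg := g_mono; rewrite vz in vg.
have := energy_eq; rewrite -/Del -/s => EE.
have EN : eps * energy z psi1 = eps * (c / 2) * (z <*> (Lu *m z)) +
   eps / (2 * c) * (psi1 <*> (L *m psi1)) by rewrite /energy; field.
rewrite mulrDl mul1r EN.
have -> : energy z psi1 = energy z0 psi0 + (energy z psi1 - energy z0 psi0) by ring.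
rewrite EE.
lra.
Qed.

End Step.

(** * Spectra of real symmetric matrices *)

Lemma psd_eigenvalues_ge0 (R : realType) n (A : 'M[R]_n) (lam : n.-tuple R) :
  A^T = A -> ordered_eigenvalues A lam ->
  (forall x : 'cV[R]_n, 0 <= ip x (A *m x)) ->
  forall t, t \in (lam : seq R) -> 0 <= t.
Proof.
move=> sA eA psd t tl.
have : eigenvalue A t by rewrite eigenvalue_root_char eA.2 root_prod_XsubC.
case/eigenvalueP => v vA v0.
have := psd v^T; rewrite -[X in X *m _]sA -trmx_mul vA linearZ /= ipZr.
by rewrite pmulr_lge0 // ip_gt0 // trmx_eq0.
Qed.

Section Spectral.
Variables (R : realType) (K : numClosedFieldType) (toC : {rmorphism R -> K}).
Local Notation conjC := (@Num.conj K).
Hypothesis conj_toC : forall x, conjC (toC x) = toC x.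
Hypothesis toC_ge0 : forall x, (0 <= toC x) = (0 <= x).

Lemma char_poly_similar (F : fieldType) n (P D : 'M[F]_n) : P \in unitmx ->
  char_poly (invmx P *m D *m P) = char_poly D.
Proof.
move=> uP; rewrite /char_poly /char_poly_mx.
have -> : 'X%:M - map_mx polyC (invmx P *m D *m P) =
   map_mx polyC (invmx P) *m ('X%:M - map_mx polyC D) *m map_mx polyC P.
  rewrite !map_mxM mulmxBr mulmxBl; congr (_ - _).
  by rewrite scalar_mxC -mulmxA -map_mxM mulVmx // map_mx1 mulmx1.
rewrite !det_mulmx mulrC mulrA -det_mulmx -map_mxM mulmxV // map_mx1 det1.
by rewrite mul1r.
Qed.

(** Over the closed extension K the real symmetric matrix is Hermitian, hence
    unitarily diagonalizable; the factorization of its characteristic polynomial over R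
    forces the diagonal to be a permutation of [lam], in particular real. *)
Lemma real_symmetric_spectral n (A : 'M[R]_n) (lam : n.-tuple R) :
  A^T = A -> ordered_eigenvalues A lam ->
  exists (U : 'M[K]_n) (s : 'I_n -> R),
    [/\ U *m (map_mx conjC U)^T = 1%:M,
        map_mx toC A = (map_mx conjC U)^T *m diag_mx (\row_i toC (s i)) *m U
      & perm_eq [seq s i | i <- enum 'I_n] lam].
Proof.
move=> sA [_ cA].
have hA : map_mx toC A \is hermsymmx.
  apply/is_hermitianmxP; rewrite expr0 scale1r.
  by apply/matrixP => i j; rewrite -[in LHS]sA !mxE conj_toC.
have /hermitian_normalmx/orthomx_spectralP := hA.
have := spectral_unitarymx (map_mx toC A).
have := spectral_unit (map_mx toC A).
move: (spectralmx _) (spectral_diag _) => U sp Uu Uun Aeq.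
have CP : \prod_(a <- [seq toC a | a <- lam]) ('X - a%:P) =
   \prod_(a <- [seq sp 0 i | i <- enum 'I_n]) ('X - a%:P).
  transitivity (char_poly (map_mx toC A)).
    rewrite big_map -map_char_poly cA rmorph_prod; apply: eq_bigr => a _.
    by rewrite /= map_polyXsubC.
  rewrite Aeq char_poly_similar // char_poly_trig ?diag_mx_is_trig //.
  by rewrite [RHS]big_map big_enum /=; apply: eq_bigr => i _; rewrite mxE eqxx.
have peq := prod_XsubC_eq CP.
have /fin_all_exists[s spE] i : exists a, sp 0 i = toC a.
  have : sp 0 i \in [seq toC a | a <- lam].
    by rewrite (perm_mem peq) map_f // mem_enum.
  by case/mapP => a _ ->; exists a.
exists U, s; split.
- by have /unitarymxP := Uun; rewrite map_trmx.
- rewrite Aeq invmx_unitary // map_trmx; congr (_ *m diag_mx _ *m _).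
  by apply/rowP => i; rewrite !mxE spE.
- apply: (perm_map_inj (fmorph_inj toC)); rewrite perm_sym -map_comp.
  by apply: (perm_trans peq); rewrite (eq_map spE).
Qed.

(** In an orthonormal eigenbasis the quadratic form of p0 + p1 A + p2 A^2 is
    diagonal, with nonnegative coefficients.  All spectral inequalities used below are
    instances of this one. *)
Lemma spectral_quad n (A : 'M[R]_n) (lam : n.-tuple R) (p0 p1 p2 : R) :
  A^T = A -> ordered_eigenvalues A lam ->
  (forall t, t \in (lam : seq R) -> 0 <= p0 + p1 * t + p2 * t ^+ 2) ->
  forall d (X : 'M[R]_(n, d)),
  0 <= p0 * ip X X + p1 * ip X (A *m X) + p2 * ip (A *m X) (A *m X).
Proof.
move=> sA eA ppos d X.
have [U [s [UU AE peq]]] := real_symmetric_spectral sA eA.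
pose B := p0%:M + p1 *: A + p2 *: (A *m A).
have -> : p0 * ip X X + p1 * ip X (A *m X) + p2 * ip (A *m X) (A *m X)
     = ip X (B *m X).
  rewrite /B !mulmxDl !ipDr mul_scalar_mx -!scalemxAl !ipZr.
  by rewrite (ip_adj X (A *m X) sA) mulmxA.
pose V := (map_mx conjC U)^T.
have VU : V *m U = 1%:M by apply: mulmx1C.
have BE : map_mx toC B =
    V *m diag_mx (\row_i toC (p0 + p1 * s i + p2 * s i ^+ 2)) *m U.
  have -> : diag_mx (\row_i toC (p0 + p1 * s i + p2 * s i ^+ 2)) =
      (toC p0)%:M + toC p1 *: diag_mx (\row_i toC (s i))
      + toC p2 *: (diag_mx (\row_i toC (s i)) *m diag_mx (\row_i toC (s i))).
    apply/matrixP => i j; rewrite mulmx_diag !mxE.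
    case: eqVneq => _; last by rewrite !mulr0n !mulr0 !addr0.
    by rewrite !mulr1n expr2 !rmorphD !rmorphM.
  rewrite /B !map_mxD !map_mxZ map_scalar_mx map_mxM AE -/V.
  rewrite !mulmxDr !mulmxDl -!scalemxAr -!scalemxAl; congr (_ + _ + _).
    by rewrite mul_mx_scalar -scalemxAl VU scalemx1.
  congr (_ *: _); rewrite !mulmxA; congr (_ *m _).
  by rewrite -!mulmxA; congr (_ *m _); congr (_ *m _); rewrite mulmxA UU mul1mx.
rewrite -toC_ge0; pose Y := U *m map_mx toC X.
suff -> : toC (ip X (B *m X)) = \sum_(j < d) \sum_(i < n)
     toC (p0 + p1 * s i + p2 * s i ^+ 2) * (Y i j * (Y i j)^*%R).
  apply: sumr_ge0 => j _; apply: sumr_ge0 => i _.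
  apply: mulr_ge0; last exact: mul_conjC_ge0.
  rewrite toC_ge0; apply: ppos.
  by rewrite -(perm_mem peq) map_f // mem_enum.
have YE : (map_mx toC X)^T *m V = (map_mx conjC Y)^T.
  rewrite /Y map_mxM trmx_mul; congr (_^T *m _).
  by apply/matrixP => i j; rewrite !mxE; exact: esym (conj_toC _).
rewrite -trace_map_mx !map_mxM BE -map_trmx !mulmxA YE -!mulmxA -/Y.
rewrite mul_diag_mx; apply: eq_bigr => j _; rewrite mxE.
apply: eq_bigr => i _; rewrite !mxE.
by rewrite mulrCA; congr (_ * _); rewrite mulrC.
Qed.

Lemma ker_const_submx n (A : 'M[R]_n.+1) : A^T = A ->
  (forall x : 'cV[R]_n.+1, A *m x = 0 -> forall i, x i 0 = x 0 0) ->
  (kermx A <= (const_mx 1 : 'rV[R]_n.+1))%MS.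
Proof.
move=> sA ker; apply/row_subP => i.
have : A *m (row i (kermx A))^T = 0.
  by rewrite -[X in X *m _]sA -trmx_mul -row_mul mulmx_ker row0 trmx0.
move=> /ker rowE; apply/sub_rVP; exists ((row i (kermx A)) 0 0).
by apply/rowP => k; have := rowE k; rewrite !mxE => ->; rewrite mulr1.
Qed.

(** If the two smallest eigenvalues vanished, two orthonormal eigenvectors would
    both lie in the kernel, that is on the line of constant vectors. *)
Lemma second_eigenvalue_gt0 n (A : 'M[R]_n.+2) (lam : n.+2.-tuple R) :
  A^T = A -> ordered_eigenvalues A lam ->
  (forall x : 'cV[R]_n.+2, 0 <= ip x (A *m x)) ->
  (forall x : 'cV[R]_n.+2, A *m x = 0 -> forall i, x i 0 = x 0 0) ->
  0 < lam`_1.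
Proof.
move=> sA eA psd ker.
have lam_ge0 := psd_eigenvalues_ge0 sA eA psd.
rewrite lt_def lam_ge0 ?mem_nth ?size_tuple // andbT.
apply/eqP => lam1; have lam0 : lam`_0 = 0.
  apply/le_anti; rewrite lam_ge0 ?mem_nth ?size_tuple // andbT -[X in _ <= X]lam1.
  by apply: (le_sorted_leq_nth 0 eA.1); rewrite ?inE ?size_tuple.
have [U [s [UU AE peq]]] := real_symmetric_spectral sA eA.
have : (1 < #|[pred i | s i == 0%R]|)%N.
  have <- : count_mem (0 : R) lam = #|[pred i | s i == 0%R]|.
    rewrite -(permP peq) count_map -sum1_count -sum1_card big_enum_cond.
    by apply: eq_bigl => i; rewrite !inE.
  case: lam lam0 lam1 {eA lam_ge0 peq} => -[|a [|b t]] //= _ -> ->.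
  by rewrite eqxx.
case/card_gt1P => i [j [/eqP si /eqP sj ij]].
have UA : U *m map_mx toC A = diag_mx (\row_i toC (s i)) *m U.
  by rewrite AE !mulmxA UU mul1mx.
have rowC k : s k = 0 -> exists a, row k U = a *: const_mx 1.
  move=> sk; apply/sub_rVP.
  have -> : const_mx 1 = map_mx toC (const_mx 1) :> 'rV[K]_n.+2.
    by apply/rowP => x; rewrite !mxE rmorph1.
  apply: submx_trans (_ : (map_mx toC (kermx A) <= _)%MS); last first.
    by rewrite map_submx; exact: ker_const_submx.
  rewrite map_kermx; apply/sub_kermxP.
  rewrite -row_mul UA; apply/rowP => x; rewrite mul_diag_mx !mxE sk.
  by rewrite rmorph0 mul0r.
have [a aE] := rowC i si; have [b bE] := rowC j sj.
have UUe p q : \sum_k U p k * conjC (U q k) = (p == q)%:R.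
  have /matrixP/(_ p q) := UU; rewrite !mxE => <-.
  by apply: eq_bigr => k _; rewrite !mxE.
have aE' k : U i k = a by have /rowP/(_ k) := aE; rewrite !mxE mulr1.
have bE' k : U j k = b by have /rowP/(_ k) := bE; rewrite !mxE mulr1.
have := UUe i j; rewrite (negbTE ij).
under eq_bigr do rewrite aE' bE'.
rewrite sumr_const => /eqP; rewrite mulrn_eq0 cardT size_enum_ord /=.
rewrite mulf_eq0 conjC_eq0 => /orP[]/eqP z0.
  have /eqP := UUe i i; rewrite eqxx big1 ?(eq_sym 0) ?oner_eq0 //.
  by move=> k _; rewrite aE' z0 mul0r.
have /eqP := UUe j j; rewrite eqxx big1 ?(eq_sym 0) ?oner_eq0 //.
by move=> k _; rewrite bE' z0 mul0r.
Qed.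

End Spectral.

(** The row space of A lies in the orthogonal complement of the constants, and both
    have codimension one, so a matrix with zero column sums is in the range of A. *)
Lemma range_pinv (R : realType) n (A : 'M[R]_n.+1) : A^T = A ->
  A *m const_mx 1 = 0 :> 'cV[R]_n.+1 ->
  (forall x : 'cV[R]_n.+1, A *m x = 0 -> forall i, x i 0 = x 0 0) ->
  forall d (Y : 'M[R]_(n.+1, d)), (const_mx 1 : 'rV[R]_n.+1) *m Y = 0 ->
  A *m ((pinvmx A)^T *m Y) = Y.
Proof.
move=> sA A1 ker d Y Y0.
apply: trmx_inj; rewrite trmx_mul sA trmx_mul trmxK; apply: mulmxKpV.
pose one : 'cV[R]_n.+1 := const_mx 1.
have sub : (A <= kermx one)%MS by apply/sub_kermxP.
suff eqA : (kermx one <= A)%MS.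
  apply: submx_trans eqA; apply/sub_kermxP.
  by have := congr1 trmx Y0; rewrite trmx_mul trmx_const trmx0.
rewrite -(geq_leqif (mxrank_leqif_sup sub)) mxrank_ker.
have one1 : \rank one = 1%N.
  rewrite -mxrank_tr trmx_const; apply/eqP; rewrite rank_rV.
  have -> // : const_mx 1 != 0 :> 'rV[R]_n.+1.
  by apply/eqP => /rowP/(_ 0); rewrite !mxE => /eqP; rewrite oner_eq0.
have := mxrankS (ker_const_submx sA ker).
rewrite mxrank_ker one1 rank_rV => h.
have : (n.+1 - \rank A <= 1)%N by apply: leq_trans h (leq_b1 _).
by rewrite !leq_subLR addnC.
Qed.

Section RealSpectral.
Variable R : realType.

Fact conj_real_complex (x : R) : Num.conj (real_complex R x) = real_complex R x.
Proof. by rewrite conj_Creal // complex_real. Qed.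

Fact real_complex_ge0 (x : R) : (0 <= real_complex R x) = (0 <= x).
Proof. by rewrite -(rmorph0 (real_complex R)) lecR. Qed.

Definition symmetric_quad_ge0 := spectral_quad conj_real_complex real_complex_ge0.
Definition second_eig_gt0 := second_eigenvalue_gt0 conj_real_complex.
End RealSpectral.

(** * Graph Laplacians *)

Section GraphFacts.
Variables (R : realType) (n : nat) (E : rel 'I_n.+1).
Hypothesis Esym : symmetric E.
Local Notation L := (laplacian E R).
Local Notation Lu := (unsigned_laplacian E R).

Lemma laplacian_sym : L^T = L.
Proof.
apply/matrixP => i j; rewrite !mxE (Esym j) eq_sym.
by case: eqVneq => [->|] //; rewrite !mulr0n.
Qed.

Lemma double_degmx : L + Lu = 2 *: degmx E R.
Proof. by rewrite /laplacian /unsigned_laplacian addrACA addNr addr0 scaler_nat. Qed.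

Lemma degmx_mulE d (X : 'M[R]_(n.+1, d)) i a :
  (degmx E R *m X) i a = (deg E i)%:R * X i a.
Proof. by rewrite mul_diag_mx !mxE. Qed.

Lemma laplacian_mulE d (X : 'M[R]_(n.+1, d)) i a :
  (L *m X) i a = \sum_(j in nbr E i) (X i a - X j a).
Proof.
rewrite mulmxBl mxE degmx_mulE [X in _ + X]mxE big_split /= sumr_const.
rewrite /deg mulr_natl sumrN; congr (_ - _).
rewrite mxE [RHS]big_mkcond /=; apply: eq_bigr => j _.
by rewrite !mxE inE; case: (E j i); rewrite ?mul1r ?mul0r.
Qed.

Lemma laplacian_const : L *m const_mx 1 = 0 :> 'cV[R]_n.+1.
Proof.
apply/colP => i; rewrite laplacian_mulE [RHS]mxE big1 // => j _.
by rewrite !mxE subrr.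
Qed.

Lemma laplacian_quad (x : 'cV[R]_n.+1) :
  2 * ip x (L *m x) = \sum_i \sum_(j in nbr E i) (x i 0 - x j 0) ^+ 2.
Proof.
have q1 : ip x (L *m x) = \sum_i \sum_j (E i j)%:R * (x i 0 * (x i 0 - x j 0)).
  rewrite ipE; apply: eq_bigr => i _; rewrite big_ord1 laplacian_mulE.
  rewrite mulr_sumr big_mkcond; apply: eq_bigr => j _.
  by rewrite inE Esym; case: (E i j); rewrite ?mul1r ?mul0r.
rewrite mulr2n mulrDl mul1r {1}q1 q1 [X in X + _]exchange_big -big_split /=.
apply: eq_bigr => i _; rewrite -big_split [RHS]big_mkcond; apply: eq_bigr => j _.
rewrite inE (Esym j i) /=; case: (E i j); rewrite ?mul1r ?mul0r ?addr0 //.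
by ring.
Qed.

Lemma laplacian_psd_col (x : 'cV[R]_n.+1) : 0 <= ip x (L *m x).
Proof.
rewrite -(pmulr_rge0 _ (ltr0Sn R 1)) laplacian_quad.
by apply: sumr_ge0 => i _; apply: sumr_ge0 => j _; exact: sqr_ge0.
Qed.

Lemma laplacian_ker (x : 'cV[R]_n.+1) : connected_graph E ->
  L *m x = 0 -> forall i, x i 0 = x 0 0.
Proof.
move=> conn Lx i.
have q0 : \sum_i \sum_(j in nbr E i) (x i 0 - x j 0) ^+ 2 = 0.
  by rewrite -laplacian_quad Lx ipC ip0l mulr0.
have edge j k : E j k -> x j 0 = x k 0.
  move=> Ejk; apply/eqP; rewrite -subr_eq0 -sqrf_eq0.
  move: q0 => /eqP; rewrite psumr_eq0 => [/allP/(_ j (mem_index_enum _)) /= |].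
    rewrite psumr_eq0 => [/allP/(_ k (mem_index_enum _)) | k' _].
      by rewrite inE Esym Ejk.
    exact: sqr_ge0.
  by move=> j' _; apply: sumr_ge0 => k' _; exact: sqr_ge0.
have /connectP[p] := conn i 0; elim: p i => [|y p IH] i /=; first by move=> _ ->.
by case/andP => /edge -> /IH h /h.
Qed.

End GraphFacts.

(** * Gradients and Hessians *)

Section Calculus.
Variables (R : realType) (d : nat).
Implicit Types (x y h : 'cV[R]_d) (f : 'cV[R]_d -> R).

Lemma dotv_ip m (x y : 'cV[R]_m) : dotv x y = ip x y.
Proof. by rewrite ipE; apply: eq_bigr => a _; rewrite big_ord1. Qed.

Lemma enorm_sqr m (x : 'cV[R]_m) : enorm x ^+ 2 = ip x x.
Proof. by rewrite /enorm sqr_sqrtr dotv_ip ?ip_ge0. Qed.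

Lemma lipschitz_grad_ip l f x x' : lipschitz_grad l f ->
  ip (grad f x' - grad f x) (grad f x' - grad f x) <= l ^+ 2 * ip (x' - x) (x' - x).
Proof.
move=> /(_ x x') lf; rewrite -!enorm_sqr -exprMn.
by apply: lerXn2r => //; rewrite ?nnegrE ?sqrtr_ge0 // (le_trans _ lf) ?sqrtr_ge0.
Qed.

Lemma hess_derive f x h : differentiable (grad f) x ->
  hess f x *m h = 'D_h (grad f) x.
Proof.
move=> df.
have -> : h = \sum_b h b 0 *: delta_mx b 0.
  by rewrite [LHS]matrix_sum_delta; apply: eq_bigr => b _; rewrite big_ord1.
rewrite deriveE // mulmx_sumr [RHS]linear_sum; apply: eq_bigr => b _.
rewrite [RHS]linearZ -scalemxAr /= -deriveE //; congr (_ *: _).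
rewrite derive_mx; last exact: diff_derivable.
apply/colP => a; rewrite mxE (bigD1 b) //= big1 => [|b' bb']; last first.
  by rewrite !mxE (negbTE bb') mulr0.
by rewrite !mxE !eqxx mulr1 addr0.
Qed.

Definition grad_quot f x h (t : R) := t^-1 *: (grad f (x + t *: h) - grad f x).

Lemma grad_quot_cvg f x h a : differentiable (grad f) x ->
  grad_quot f x h t a 0 @[t --> 0^'] --> (hess f x *m h) a 0.
Proof.
move=> df; rewrite hess_derive //.
have /(_ h) := diff_derivable df; rewrite /derivable => dq.
have : grad_quot f x h t @[t --> 0^'] --> 'D_h (grad f) x.
  have -> : grad_quot f x h = (fun t : R => t^-1 *: ((grad f \o shift x) (t *: h) - grad f x)).
    by apply/funext => t; rewrite /grad_quot /= (addrC x).
  exact: dq.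
move=> cq.
have := @continuous_cvg _ _ _ _ _ _ (fun N : 'cV[R]_d => N a 0 : R) _
  (@coord_continuous R d 1 a 0 _) cq.
by apply.
Qed.

Lemma ip_cvg (T : Type) (G : set_system T) m (u w : T -> 'cV[R]_m) (a b : 'cV[R]_m) :
  Filter G -> (forall i, u t i 0 @[t --> G] --> a i 0) ->
  (forall i, w t i 0 @[t --> G] --> b i 0) ->
  ip (u t) (w t) @[t --> G] --> ip a b.
Proof.
move=> FG ua wb; rewrite -dotv_ip.
under eq_cvg do rewrite -dotv_ip.
by apply: cvg_big => [|i _]; [exact: add_continuous | exact: cvgM].
Qed.

(** Limit of the strong convexity inequality between x and x + t h. *)
Lemma hess_monotone v f x h : differentiable (grad f) x -> strongly_convex v f ->
  v * ip h h <= ip (hess f x *m h) h.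
Proof.
move=> df sc.
have cq : ip (grad_quot f x h t) h @[t --> 0^'] --> ip (hess f x *m h) h.
  by apply: ip_cvg => a; [exact: grad_quot_cvg | exact: cvg_cst].
apply: (cvgr_to_ge cq); near=> t.
have t0 : t != 0 by near: t; exact: nbhs_dnbhs_neq.
have t2 : 0 < t ^+ 2 by rewrite exprn_even_gt0.
have := sc x (x + t *: h); rewrite addrAC subrr add0r enorm_sqr dotv_ip.
rewrite /grad_quot !(ipZl, ipZr) => le; rewrite -(ler_pM2l t2).
apply: (le_trans (le_trans _ le)); first by rewrite le_eqVlt; apply/orP; left; apply/eqP; ring.
by rewrite le_eqVlt; apply/orP; left; apply/eqP; field.
Unshelve. all: by end_near. Qed.

(** Limit of the Lipschitz inequality between x and x + t h. *)
Lemma hess_bounded l f x h : differentiable (grad f) x -> lipschitz_grad l f ->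
  ip (hess f x *m h) (hess f x *m h) <= l ^+ 2 * ip h h.
Proof.
move=> df lf.
have cq : ip (grad_quot f x h t) (grad_quot f x h t) @[t --> 0^']
    --> ip (hess f x *m h) (hess f x *m h).
  by apply: ip_cvg => a; exact: grad_quot_cvg.
apply: (cvgr_to_le cq); near=> t.
have t0 : t != 0 by near: t; exact: nbhs_dnbhs_neq.
have t2 : 0 < t ^+ 2 by rewrite exprn_even_gt0.
have := lipschitz_grad_ip x (x + t *: h) lf; rewrite [x + _ - x]addrAC subrr add0r.
rewrite /grad_quot !(ipZl, ipZr) => le; rewrite -(ler_pM2l t2).
apply: (le_trans (le_trans _ le)); last by rewrite le_eqVlt; apply/orP; left; apply/eqP; ring.
by rewrite le_eqVlt; apply/orP; left; apply/eqP; field.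
Unshelve. all: by end_near. Qed.

(** The one-sided difference quotients are nonnegative in the directions h and - h,
    and the derivative is odd in h. *)
Lemma minimizer_derive (g : 'cV[R]_d -> R) x h :
  (forall z, g x <= g z) -> differentiable g x -> 'D_h g x = 0.
Proof.
move=> gmin dg.
have ge0 h' : 0 <= 'D_h' g x.
  have dh : derivable g x h' by exact: diff_derivable.
  rewrite /derive cvg_at_rightE //; apply: limr_ge.
    rewrite -(cvg_at_rightE (fun t => t^-1 *: ((g \o shift x) (t *: h') - g x))) //.
    apply: cvg_trans dh; apply: cvg_app.
    move=> A [e egt0 Ae]; exists e => // y ye ygt0; apply: Ae => //.
    exact/lt0r_neq0.
  near=> t; apply: mulr_ge0; last by rewrite subr_ge0; exact: gmin.
  by rewrite invr_ge0 ltW.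
apply/le_anti; rewrite ge0 andbT -oppr_ge0.
by have := ge0 (- h); rewrite !deriveE // linearN.
Unshelve. all: by end_near. Qed.

Lemma sum_grad_minimizer n (F : 'I_n -> 'cV[R]_d -> R) x :
  (forall i, differentiable (F i) x) ->
  is_minimizer (fun z => \sum_i F i z) x -> \sum_i grad (F i) x = 0.
Proof.
move=> dF xmin; apply/colP => a; rewrite summxE mxE.
under eq_bigr do rewrite mxE.
rewrite -derive_sum => [|i]; last exact: diff_derivable.
apply: minimizer_derive; last exact: differentiable_sum.
by move=> z; have := xmin z; rewrite !fct_sumE.
Qed.

(** A kernel vector w would satisfy v |w|^2 <= <hess w, w> = - k |w|^2. *)
Lemma shifted_hess_unit (v : R) f x (k : R) : differentiable (grad f) x ->
  0 < v -> 0 <= k -> strongly_convex v f -> k%:M + hess f x \in unitmx.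
Proof.
move=> df v0 k0 sc; rewrite -unitmx_tr -row_free_unit -kermx_eq0.
apply/rowV0P => w /sub_kermxP wH.
have /(congr1 trmx) := wH; rewrite trmx_mul trmxK trmx0 mulmxDl mul_scalar_mx => Hw.
have : 0 <= v * ip w^T w^T <= 0.
  rewrite mulr_ge0 ?ip_ge0 ?(ltW v0) //=.
  apply: (le_trans (hess_monotone w^T df sc)).
  have -> : hess f x *m w^T = - (k *: w^T).
    by apply/eqP; rewrite -addr_eq0 addrC Hw.
  by rewrite ipNl ipZl oppr_le0 mulr_ge0 // ip_ge0.
rewrite -eq_le eq_sym mulf_eq0 gt_eqF //= ip_eq0 => /eqP w0.
by apply: trmx_inj; rewrite w0 trmx0.
Qed.
End Calculus.

(** * Borel measurability of vectors and matrices *)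

Section BorelVec.
Variables (R : realType) (d : nat).
Local Notation V := (borel_vec R d).

Lemma continuous_borel (g : 'cV[R]_d -> R) : continuous g ->
  measurable_fun setT (g : V -> R).
Proof.
move=> cg; apply: (measurability _ (RGenOpens.measurableE R)).
move=> _ [_ [a [b ->] <-]]; rewrite setTI; apply: sub_sigma_algebra.
by have /continuousP := cg; apply; exact: interval_open.
Qed.

(** Balls of the max norm with rational centre and radius 1/m form a countable
    base; this reduces Borel measurability of vectors to that of their coordinates. *)
Lemma open_rational_boxes (U : set 'cV[R]_d) : open U ->
  U = \bigcup_(p in [set p : 'cV[rat]_d * nat |
        ball (map_mx (@ratr R) p.1) p.2.+1%:R^-1 `<=` U])
      ball (map_mx (@ratr R) p.1) p.2.+1%:R^-1.
Proof.
move=> oU; apply/seteqP; split=> [x Ux|x [p]]; last by move=> /= /[apply].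
have /nbhs_ballP[e /= e0 eU] : nbhs x U by exact: open_nbhs_nbhs.
(* The radius is below e / 2, so that a box around x of this radius stays in the
   e-ball of x. *)
pose k := Num.truncn (e / 2)^-1.
have ke : k.+1%:R^-1 < e / 2.
  rewrite -ltf_pV2 ?posrE ?invr_gt0 ?divr_gt0 // invrK.
  by apply: truncnS_gt.
have k0 : 0 < k.+1%:R^-1 :> R by rewrite invr_gt0.
have /fin_all_exists[q qE] (a : 'I_d) :
    exists q : rat, ball (x a 0) k.+1%:R^-1 (ratr q).
  have [q /= qin] := rat_in_itvoo (ltr_pwDr k0 (lexx (x a 0))).
  exists q; rewrite /ball /= ltr_distlC; move: qin; rewrite in_itv /=.
  by case/andP => h1 ->; rewrite andbT (lt_trans _ h1) // ltrBlDr ltrDl.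
have qb : ball (map_mx (@ratr R) (\col_a q a)) k.+1%:R^-1 x.
  by apply: ball_sym; split=> // a b; rewrite !mxE (ord1 b).
exists (\col_a q a, k) => //= y yb; apply: eU.
rewrite (splitr e); apply: (@ball_triangle _ _ (map_mx (@ratr R) (\col_a q a))).
  exact: (le_ball (ltW ke) (ball_sym qb)).
exact: (le_ball (ltW ke) yb).
Qed.

Lemma measurable_vecP dT (T : measurableType dT) (Z : T -> 'cV[R]_d) :
  measurable_fun setT (Z : T -> V) <->
  forall a, measurable_fun setT (fun w => Z w a 0).
Proof.
split=> [mZ a|mZ].
  have mc := @continuous_borel (fun x => x a 0) (@coord_continuous R d 1 a 0).
  exact: (measurableT_comp mc mZ).
apply: (measurability _ (erefl : @measurable _ V = <<s @open 'cV[R]_d >>)).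
move=> _ [U oU <-]; rewrite setTI (open_rational_boxes oU) preimage_bigcup.
rewrite bigcup_mkcond; apply: countable_bigcupT_measurable => [|p].
  exact: countableP.
case: ifPn => // _.
have -> : Z @^-1` ball (map_mx (@ratr R) p.1) p.2.+1%:R^-1 =
    \bigcap_(a in [set: 'I_d]) ((fun w => Z w a 0) @^-1`
        ball (ratr (p.1 a 0) : R) p.2.+1%:R^-1).
  apply/seteqP; split=> [w /= [_ h] a _ /=|w h /=].
    by have := h a 0; rewrite mxE.
  split; first by rewrite invr_gt0.
  by move=> a b; rewrite (ord1 b) mxE; exact: h.
apply: fin_bigcap_measurable => // a _.
by rewrite -[X in measurable X]setTI; apply: mZ => //; exact: measurable_ball.
Qed.
End BorelVec.

Section MeasurableMatrix.
Context (R : realType) (dT : measure_display) (T : measurableType dT).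

(** Writing 1/x as x (x^2)^(-1) reduces the claim to a power of a nonnegative
    number, and takes the right value at 0. *)
Lemma measurable_invr (D : set T) (f : T -> R) : measurable_fun D f ->
  measurable_fun D (fun w => (f w)^-1).
Proof.
move=> mf.
have -> : (fun w => (f w)^-1) = (fun w => f w * powR (f w ^+ 2) (-1)).
  apply/funext => w; have [->|f0] := eqVneq (f w) 0; first by rewrite invr0 mul0r.
  by rewrite powR_inv1 ?sqr_ge0 // expr2 invfM mulrA divff // mul1r.
apply: measurable_funM => //; apply: measurableT_comp (measurable_powR _) _.
exact: measurable_funX.
Qed.

Lemma measurable_det n (M : T -> 'M[R]_n) :
  (forall i j, measurable_fun setT (fun w => M w i j)) ->
  measurable_fun setT (fun w => \det (M w)).
Proof.
move=> mM; apply: measurable_sum => s.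
apply: measurable_funM => //; apply: measurable_prod => i _; exact: mM.
Qed.

Lemma measurable_invmx n (M : T -> 'M[R]_n) :
  (forall w, M w \in unitmx) ->
  (forall i j, measurable_fun setT (fun w => M w i j)) ->
  forall i j, measurable_fun setT (fun w => invmx (M w) i j).
Proof.
move=> uM mM i j.
under eq_fun do rewrite /invmx uM !mxE /cofactor.
apply: measurable_funM; first exact/measurable_invr/measurable_det.
apply: measurable_funM => //; apply: measurable_det => a b.
by under eq_fun do rewrite !mxE; exact: mM.
Qed.

Lemma measurable_mulmx m n p (M : T -> 'M[R]_(m, n)) (N : T -> 'M[R]_(n, p)) :
  (forall i j, measurable_fun setT (fun w => M w i j)) ->
  (forall i j, measurable_fun setT (fun w => N w i j)) ->
  forall i j, measurable_fun setT (fun w => (M w *m N w) i j).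
Proof.
move=> mM mN i j; under eq_fun do rewrite mxE.
by apply: measurable_sum => k; exact: measurable_funM.
Qed.
End MeasurableMatrix.

(** * Measurability of the iteration *)

Section BorelGradient.
Variables (R : realType) (d : nat) (f : 'cV[R]_d -> R).
Hypothesis df : forall x, differentiable (grad f) x.

Lemma grad_coord_continuous a : continuous (fun x => grad f x a 0).
Proof.
move=> x; have cg := differentiable_continuous (df x).
exact: (continuous_comp cg (@coord_continuous R d 1 a 0 _)).
Qed.

(** The Hessian is only assumed to exist, not to be continuous, but it is a
    pointwise limit of difference quotients of the continuous gradient. *)
Lemma hess_borel a b : measurable_fun setT (fun x : borel_vec R d => hess f x a b).
Proof.
pose u (m : nat) (x : borel_vec R d) : R :=
  m.+1%:R * (grad f (x + m.+1%:R^-1 *: delta_mx b 0) a 0 - grad f x a 0).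
apply: (measurable_fun_cvg (h := u)) => [m|x _].
  apply: measurable_funM => //; apply: measurable_funB.
    apply: (@continuous_borel _ _ (fun x => grad f (x + m.+1%:R^-1 *: delta_mx b 0) a 0)).
    move=> x; have ct : {for x, continuous (fun z : 'cV[R]_d => z + m.+1%:R^-1 *: delta_mx b 0)}.
      by apply: continuousD; [exact: cvg_id | exact: cst_continuous].
    have cc := continuous_comp ct (grad_coord_continuous (a := a) (x := _)). exact: cc.
  apply: continuous_borel; exact: grad_coord_continuous.
pose z : 'cV[R]_d := x.
have := grad_quot_cvg (h := delta_mx b 0) (a := a) (df z).
have -> : (hess f z *m (delta_mx b 0 : 'cV[R]_d)) a 0 = hess f x a b.
  by rewrite -colE mxE.
move=> cq.
have hm : (m.+1%:R^-1 : R) @[m --> \oo] --> 0^'.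
  move=> A A0; have hA := @cvg_harmonic R (fun y => y != 0 -> A y) A0.
  have hB : \forall m \near \oo, harmonic m != 0 -> A (harmonic m) := hA.
  by apply: filterS hB => m Am; apply: Am; rewrite /harmonic /= invr_eq0 pnatr_eq0.
have := cvg_comp _ _ hm cq.
by apply: cvg_trans; apply: near_eq_cvg; near=> m; rewrite /u /grad_quot /= !mxE invrK.
Unshelve. all: by end_near. Qed.

End BorelGradient.

Section Update.
Variables (R : realType) (n d : nat) (E : rel 'I_n) (f : 'I_n -> 'cV[R]_d -> R).
Variable (c : R).

Definition forcing (st : state R n d) i : 'cV[R]_d :=
  grad (f i) (x_ st i) + c *: (\sum_(j in nbr E i) (y_ st i - y_ st j)) + phi_ st i.

Definition shifted_hess (st : state R n d) i : 'M[R]_d :=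
  (2 * c * (deg E i)%:R)%:M + hess (f i) (y_ st i).

Definition primal_update (st : state R n d) i : 'cV[R]_d :=
  x_ st i - invmx (shifted_hess st i) *m forcing st i.

Variables (S : Type) (C : S -> 'cV[R]_d -> 'cV[R]_d) (mu : nat -> R).
Variables (x0 : 'I_n -> 'cV[R]_d) (s : 'I_n -> nat -> S).
Local Notation st k := (ccdqm E f C c mu x0 s k).

Lemma x_step k i : x_ (st k.+1) i = primal_update (st k) i.
Proof. by rewrite /primal_update /=; case: (st k). Qed.

Definition offset k i := primal_update (st k) i - y_ (st k) i.

Lemma y_step k i : y_ (st k.+1) i =
  if mu k <= enorm (offset k i)
  then y_ (st k) i + C (s i k) (offset k i) else y_ (st k) i.
Proof. by rewrite /offset /primal_update /=; case: (st k). Qed.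

Lemma phi_step k i : phi_ (st k.+1) i =
  phi_ (st k) i + c *: (\sum_(j in nbr E i) (y_ (st k.+1) i - y_ (st k.+1) j)).
Proof. by rewrite /=; case: (st k). Qed.

Lemma error_step k i : x_ (st k.+1) i - y_ (st k.+1) i =
  if mu k <= enorm (offset k i)
  then offset k i - C (s i k) (offset k i) else offset k i.
Proof. by rewrite x_step y_step; case: ifP; rewrite // opprD addrA. Qed.

End Update.

Section StateMeasurable.
Variables (R : realType) (n d : nat) (E : rel 'I_n) (f : 'I_n -> 'cV[R]_d -> R).
Variables (c : R) (mu : nat -> R) (x0 : 'I_n -> 'cV[R]_d).
Variables (dS : measure_display) (S : measurableType dS).
Variable (C : S -> 'cV[R]_d -> 'cV[R]_d).
Hypothesis df : forall i x, differentiable (grad (f i)) x.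
Hypothesis unit_sh : forall (st : state R n d) i, shifted_hess E f c st i \in unitmx.
Hypothesis mC : jointly_measurable C.
Context (dT : measure_display) (T : measurableType dT).
Local Notation mvec Z := (measurable_fun [set: T] (Z : T -> borel_vec R d)).

Definition mstate (st : T -> state R n d) :=
  forall i, [/\ mvec (fun w => x_ (st w) i), mvec (fun w => y_ (st w) i)
              & mvec (fun w => phi_ (st w) i)].

Lemma mvecD Y Z : mvec Y -> mvec Z -> mvec (fun w => Y w + Z w).
Proof.
move=> /measurable_vecP mY /measurable_vecP mZ; apply/measurable_vecP => a.
by under eq_fun do rewrite mxE; exact: measurable_funD.
Qed.

Lemma mvecZ k Z : mvec Z -> mvec (fun w => k *: Z w).
Proof.
move=> /measurable_vecP mZ; apply/measurable_vecP => a.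
by under eq_fun do rewrite mxE; exact: measurable_funM.
Qed.

Lemma mvecB Y Z : mvec Y -> mvec Z -> mvec (fun w => Y w - Z w).
Proof.
move=> mY mZ; under eq_fun do rewrite -scaleN1r.
by apply: mvecD => //; exact: mvecZ.
Qed.

Lemma mvec_sum (I : Type) (r : seq I) (P : pred I) (Z : I -> T -> 'cV[R]_d) :
  (forall i, mvec (Z i)) -> mvec (fun w => \sum_(i <- r | P i) Z i w).
Proof.
move=> mZ; elim: r => [|i r IH].
  by under eq_fun do rewrite big_nil; exact: measurable_cst.
under eq_fun do rewrite big_cons; case: (P i) => //.
by apply: mvecD.
Qed.

Lemma mvec_ip Y Z : mvec Y -> mvec Z -> measurable_fun [set: T] (fun w => ip (Y w) (Z w)).
Proof.
move=> /measurable_vecP mY /measurable_vecP mZ.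
under eq_fun do rewrite -dotv_ip.
by apply: measurable_sum => a; exact: measurable_funM.
Qed.

Lemma mvec_grad g Z : (forall x, differentiable (grad g) x) -> mvec Z ->
  mvec (fun w => grad g (Z w)).
Proof.
move=> dg mZ; apply/measurable_vecP => a.
have mg := continuous_borel (grad_coord_continuous dg (a := a)).
exact: (measurableT_comp mg mZ).
Qed.

Lemma mvec_primal st : mstate st ->
  forall i, mvec (fun w => primal_update E f c (st w) i).
Proof.
move=> mst i; have [mx my mp] := mst i.
apply: mvecB => //; apply/measurable_vecP => a.
apply: measurable_mulmx => [p q|p q].
  apply: measurable_invmx => [w|p' q']; first exact: unit_sh.
  rewrite /shifted_hess; under eq_fun do rewrite mxE.
  apply: measurable_funD => //.
  exact: (measurableT_comp (hess_borel (df i) p' q') my).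
rewrite (ord1 q); apply: (measurable_vecP _).1 p.
apply: mvecD => //; apply: mvecD; first exact: mvec_grad.
apply: mvecZ; apply: mvec_sum => j; apply: mvecB => //.
by have [] := mst j.
Qed.

Lemma measurable_enorm Z : mvec Z -> measurable_fun [set: T] (fun w => enorm (Z w)).
Proof.
move=> mZ; rewrite /enorm; under eq_fun do rewrite dotv_ip -powR12_sqrt ?ip_ge0 //.
by apply: (measurableT_comp (measurable_powR _)); exact: mvec_ip.
Qed.

Lemma mvec_ite (b : T -> bool) Y Z : measurable_fun [set: T] b -> mvec Y -> mvec Z ->
  mvec (fun w => if b w then Y w else Z w).
Proof. by move=> mb mY mZ; exact: measurable_fun_ifT. Qed.

Lemma mvec_compress (xi : T -> S) Z : measurable_fun [set: T] xi -> mvec Z ->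
  mvec (fun w => C (xi w) (Z w)).
Proof.
move=> mxi mZ; exact: (measurableT_comp mC (measurable_fun_pair mxi mZ)).
Qed.

(** Stated for an arbitrary sigma-algebra that makes the seeds before k measurable:
    it is applied both to the ambient sigma-algebra and to the one generated by the past,
    the latter giving independence from the next seed. *)
Lemma mstate_ccdqm (xi : 'I_n -> nat -> T -> S) k :
  (forall i m, (m < k)%N -> measurable_fun [set: T] (xi i m)) ->
  mstate (fun w => ccdqm E f C c mu x0 (fun i k => xi i k w) k).
Proof.
elim: k => [|k IH] mxi; first by move=> i; split; exact: measurable_cst.
have {}IH : mstate (fun w => ccdqm E f C c mu x0 (fun i k => xi i k w) k).
  by apply: IH => i m mk; apply: mxi; exact: ltnW.
have mx i : mvec (fun w => x_ (ccdqm E f C c mu x0 (fun i k => xi i k w) k.+1) i).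
  under eq_fun do rewrite x_step; exact: mvec_primal.
have my i : mvec (fun w => y_ (ccdqm E f C c mu x0 (fun i k => xi i k w) k.+1) i).
  have [_ my _] := IH i.
  have mo : mvec (fun w => offset E f c C mu x0 (fun i k => xi i k w) k i).
    by apply: mvecB => //; exact: mvec_primal.
  under eq_fun do rewrite y_step.
  apply: mvec_ite => //.
    by apply: measurable_fun_ler => //; exact: measurable_enorm.
  by apply: mvecD => //; apply: mvec_compress => //; exact: mxi.
move=> i; split=> //; have [_ _ mp] := IH i.
under eq_fun do rewrite phi_step.
by apply: mvecD => //; apply: mvecZ; apply: mvec_sum => j; exact: mvecB.
Qed.

End StateMeasurable.

(** * Independent seeds and the mean compression error *)

Section Independence.
Local Open Scope ereal_scope.
Context (R : realType) d1 (S : measurableType d1) d2 (V : measurableType d2)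
  dT (T : measurableType dT) (P : probability T R) (Q : probability S R).

(** Independence says that the joint law of (X, Z) agrees with the product of the
    laws on rectangles, hence everywhere; then Tonelli. *)
Lemma independent_integral (X : T -> S) (Z : T -> V) (h : S * V -> \bar R) :
  measurable_fun setT X -> measurable_fun setT Z ->
  (forall A B, measurable A -> measurable B ->
     P (X @^-1` A `&` Z @^-1` B) = Q A * P (Z @^-1` B)) ->
  measurable_fun setT h -> (forall p, 0 <= h p) ->
  \int[P]_w h (X w, Z w) = \int[P]_w \int[Q]_s h (s, Z w).
Proof.
move=> mX mZ indep mh h0.
pose Zmix := isMeasurableFun.Build _ _ _ _ _ mZ.
pose Zp : {mfun T >-> V} := HB.pack Z Zmix.
have mXZ : measurable_fun setT (fun w => (X w, Z w)) by exact: measurable_fun_pair.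
pose XZmix := isMeasurableFun.Build _ _ _ _ _ mXZ.
pose XZp : {mfun T >-> (S * V)%type} := HB.pack (fun w => (X w, Z w)) XZmix.
pose m2 := distribution P Zp.
pose m' := distribution P XZp.
transitivity (\int[m']_p h p).
  by rewrite /m' /distribution ge0_integral_pushforward // preimage_setT.
transitivity (\int[Q \x m2]_p h p).
  apply: eq_measure_integral => A mA _.
  apply/esym; apply: product_measure_unique => // A' B mA' mB.
rewrite fubini_tonelli2 //.
rewrite /m2 /distribution ge0_integral_pushforward // ?preimage_setT //.
  exact: measurable_fun_fubini_tonelli_G.
by move=> y _; apply: integral_ge0.
Qed.
End Independence.

Section RealExpectation.
Context (R : realType) dT (T : measurableType dT) (P : probability T R).
Implicit Types (u w : T -> R).

Definition integ u := P.-integrable [set: T] (EFin \o u).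
Definition Ex u : R := \int[P]_t u t.

Lemma integ_cst k : integ (fun=> k).
Proof. exact: finite_measure_integrable_cst. Qed.

Lemma integD u w : integ u -> integ w -> integ (fun t => u t + w t).
Proof. by move=> iu iw; apply: eq_integrable (integrableD measurableT iu iw). Qed.

Lemma integZ k u : integ u -> integ (fun t => k * u t).
Proof. by move=> iu; apply: eq_integrable (integrableZl measurableT k iu). Qed.

Lemma integ_sum (I : Type) (r : seq I) (Pr : pred I) (u : I -> T -> R) :
  (forall i, integ (u i)) -> integ (fun t => \sum_(i <- r | Pr i) u i t).
Proof.
move=> iu; elim: r => [|i r IH].
  by under eq_fun do rewrite big_nil; exact: integ_cst.
under eq_fun do rewrite big_cons; case: (Pr i) => //.
exact: integD.
Qed.

Lemma integ_measurable u : integ u -> measurable_fun [set: T] u.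
Proof. by move=> /measurable_int /measurable_EFinP. Qed.

Lemma integ_le u w : measurable_fun [set: T] u -> (forall t, `|u t| <= w t) ->
  integ w -> integ u.
Proof.
move=> mu uw iw; apply: le_integrable iw => //; first exact/measurable_EFinP.
move=> t _ /=; rewrite lee_fin (le_trans (uw t)) //.
exact: ler_norm.
Qed.

Lemma ExD u w : integ u -> integ w -> Ex (fun t => u t + w t) = Ex u + Ex w.
Proof. exact: RintegralD. Qed.

Lemma ExZ k u : integ u -> Ex (fun t => k * u t) = k * Ex u.
Proof. exact: RintegralZl. Qed.

Lemma Ex_cst k : Ex (fun=> k) = k.
Proof. by rewrite /Ex Rintegral_cst // (_ : _ setT = 1%E) ?mulr1 //; exact: probability_setT. Qed.

Lemma Ex_sum (I : Type) (r : seq I) (Pr : pred I) (u : I -> T -> R) :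
  (forall i, integ (u i)) ->
  Ex (fun t => \sum_(i <- r | Pr i) u i t) = \sum_(i <- r | Pr i) Ex (u i).
Proof.
move=> iu; elim: r => [|i r IH].
  by rewrite big_nil; under eq_fun do rewrite big_nil; exact: Ex_cst.
rewrite big_cons; under eq_fun do rewrite big_cons; case: (Pr i) => //.
by rewrite ExD ?IH //; exact: integ_sum.
Qed.

Lemma le_Ex u w : integ u -> integ w -> (forall t, u t <= w t) -> Ex u <= Ex w.
Proof. by move=> iu iw uw; apply: le_Rintegral. Qed.

Lemma Ex_ge0 u : (forall t, 0 <= u t) -> 0 <= Ex u.
Proof. by move=> u0; apply: Rintegral_ge0. Qed.

Lemma ExE u : integ u -> (\int[P]_t (u t)%:E = (Ex u)%:E)%E.
Proof. by move=> iu; rewrite /Ex /Rintegral fineK //; exact: integrable_fin_num. Qed.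

Lemma integ_lty u k : measurable_fun [set: T] u -> (forall t, 0 <= u t) ->
  (\int[P]_t (u t)%:E <= k%:E)%E -> integ u.
Proof.
move=> mu u0 le; apply/integrableP; split; first exact/measurable_EFinP.
apply: le_lt_trans (ltry k); apply: le_trans le.
rewrite le_eqVlt; apply/orP; left; apply/eqP.
by apply: eq_integral => t _ /=; rewrite ger0_norm.
Qed.

(** The variance is nonnegative. *)
Lemma Ex_sqr u : integ u -> integ (fun t => u t ^+ 2) -> Ex u ^+ 2 <= Ex (fun t => u t ^+ 2).
Proof.
move=> iu iu2; set m := Ex u.
have : 0 <= Ex (fun t => (u t ^+ 2 + (- 2 * m) * u t) + m ^+ 2).
  apply: Ex_ge0 => t; have := sqr_ge0 (u t - m).
  by rewrite sqrrB; lra.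
rewrite !(ExD, ExZ, Ex_cst) //; try exact: integ_cst; try exact: integZ.
  by rewrite -/m; lra.
by apply: integD => //; exact: integZ.
Qed.
End RealExpectation.

Section FreshCompression.
Context (R : realType) (n d : nat) dS (S : measurableType dS) (Q : probability S R)
  dT (T : measurableType dT) (P : probability T R) (xi : 'I_n -> nat -> T -> S).
Hypothesis fresh : fresh_seeds Q P xi.

Definition past_gen (k : nat) : set (set T) :=
  [set B | exists (j : 'I_n) (m : nat) (A : set S),
         [/\ (m < k)%N, measurable A & B = xi j m @^-1` A] ].

Lemma seed_past_measurable j m k : (m < k)%N ->
  measurable_fun [set: g_sigma_algebraType (past_gen k)] (xi j m).
Proof.
move=> mk _ A mA; rewrite setTI; apply: sub_sigma_algebra.
by exists j, m, A.
Qed.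

Variables (C : S -> 'cV[R]_d -> 'cV[R]_d) (delta : R).
Hypothesis delta_ge0 : 0 <= delta.
Hypothesis contr : contractive_compressor Q delta C.

Definition sent_error (mu : R) (s : S) (z : 'cV[R]_d) :=
  if mu <= enorm z then z - C s z else z.

(** When nothing is transmitted, the error is the input itself, which is shorter
    than the threshold. *)
Lemma sent_error_bound mu z : (0 <= mu) ->
  (\int[Q]_s (ip (sent_error mu s z) (sent_error mu s z))%:E <=
   (delta * ip z z + mu ^+ 2)%:E)%E.
Proof.
move=> mu0; rewrite /sent_error; case: (boolP (mu <= enorm z)) => [_|].
  have [_ Hc] := contr; have Hz := Hc z; rewrite unlock (enorm_sqr z) in Hz.
  have -> : (\int[Q]_s (ip (z - C s z) (z - C s z))%:E = \int[Q]_s (enorm (z - C s z) ^+ 2)%:E)%E.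
    by apply: eq_integral => s _; rewrite enorm_sqr.
  by apply: (le_trans Hz); rewrite lee_fin lerDl sqr_ge0.
rewrite -ltNge => zmu; rewrite integral_cst //= probability_setT mule1 lee_fin.
apply: (@le_trans _ _ (mu ^+ 2)); last by rewrite lerDr mulr_ge0 // ip_ge0.
by rewrite -enorm_sqr; apply: lerXn2r; rewrite ?nnegrE ?sqrtr_ge0 // ltW.
Qed.

Lemma sent_error_measurable (mu : R) : measurable_fun [set: (S * borel_vec R d)%type]
  (fun p : S * borel_vec R d => (ip (sent_error mu p.1 p.2) (sent_error mu p.1 p.2))%:E).
Proof.
have [mC _] := contr.
apply/measurable_EFinP; apply: mvec_ip; apply: mvec_ite.
all: try (apply: measurable_fun_ler => //; apply: measurable_enorm).
all: try exact: measurable_snd.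
all: by apply: mvecB; [exact: measurable_snd|exact: mC].
Qed.

(** Integrate [sent_error_bound] over the law of Z; the measurability of Z with
    respect to the past is what makes it independent of the seed number k. *)
Lemma fresh_error_bound i k mu (Z : T -> 'cV[R]_d) : 0 <= mu ->
  measurable_fun [set: g_sigma_algebraType (past_gen k)] (Z : _ -> borel_vec R d) ->
  measurable_fun [set: T] (Z : _ -> borel_vec R d) ->
  integ P (fun w => ip (Z w) (Z w)) ->
  let e w := sent_error mu (xi i k w) (Z w) in
  integ P (fun w => ip (e w) (e w)) /\
  Ex P (fun w => ip (e w) (e w)) <= delta * Ex P (fun w => ip (Z w) (Z w)) + mu ^+ 2.
Proof.
move=> mu0 pZ mZ iZ e; have [mxi lxi ixi] := fresh.
pose h (p : S * borel_vec R d) : \bar R :=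
  (ip (sent_error mu p.1 p.2) (sent_error mu p.1 p.2))%:E.
have mh : measurable_fun setT h by exact: sent_error_measurable.
have h0 p : (0 <= h p)%E by rewrite lee_fin ip_ge0.
have iE : (\int[P]_w (ip (e w) (e w))%:E = \int[P]_w \int[Q]_s h (s, Z w))%E.
  apply: (@independent_integral _ _ S _ (borel_vec R d) _ T P Q (xi i k) Z h) => //.
  move=> A B mA mB; rewrite ixi // ?lxi //.
  by have := pZ measurableT B mB; rewrite setTI.
have iZ2 : integ P (fun w => delta * ip (Z w) (Z w) + mu ^+ 2).
  by apply: integD; [exact: integZ | exact: integ_cst].
have le : (\int[P]_w (ip (e w) (e w))%:E <=
    (delta * Ex P (fun w => ip (Z w) (Z w)) + mu ^+ 2)%:E)%E.
  have -> : delta * Ex P (fun w => ip (Z w) (Z w)) + mu ^+ 2 =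
      Ex P (fun w => delta * ip (Z w) (Z w) + mu ^+ 2).
    by rewrite ExD ?ExZ ?Ex_cst //; do ?[exact: integ_cst | exact: integZ].
  rewrite iE -ExE //; apply: ge0_le_integral => //.
  - by move=> w _; apply: integral_ge0 => s _.
  - have mF := @measurable_fun_fubini_tonelli_G _ _ S (borel_vec R d) R Q h mh h0.
    exact: (measurableT_comp mF mZ).
  - by apply/measurable_EFinP; exact: integ_measurable iZ2.
  - move=> w _; exact: sent_error_bound.
have me : measurable_fun [set: T] (fun w => ip (e w) (e w)).
  apply/measurable_EFinP.
  exact: (measurableT_comp mh (measurable_fun_pair (mxi i k) mZ)).
have ie : integ P (fun w => ip (e w) (e w)).
  by apply: integ_lty le => // w; exact: ip_ge0.
by split=> //; rewrite -lee_fin -ExE.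
Qed.
End FreshCompression.

(** * Choice of the Lyapunov parameters *)

Section ParameterChoice.
Variable R : realType.

(** At eps = 0 the last inequality is strict by the hypothesis on delta, and
    every quantity is a continuous function of eps there; so it persists for a small
    eps > 0.  Here theta is the weight of the compression error in the Lyapunov function
    and B the resulting total weight of the new error: the two linear equations say that
    the old error is exactly compensated. *)
Lemma parameter_choice (c v l lam2 lamn hlam1 hlamn beta delta : R) :
  0 < c -> 0 < v -> 0 < lam2 -> 0 < lamn -> 0 <= delta -> delta < 1 ->
  l ^+ 2 / (2 * c * lam2 * v) < beta ->
  let G := Gfun c v l lam2 hlam1 hlamn beta in
  0 < G ->
  delta / (1 - Num.sqrt delta) ^+ 2 <
    G / (3 * c * lamn + 2 * c * beta * lamn + c * lamn ^+ 2 / (beta * lam2)) ->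
  exists eps eta chi theta B : R,
  let q := Num.sqrt delta in
  let a := c * lamn / 2 + 4 * chi * c ^+ 2 * lamn ^+ 2 in
  let b := 2 * c * beta * lamn + 4 * chi * c ^+ 2 * lamn ^+ 2 in
  [/\ 0 < eps, 0 < eta & chi = ((8 * c * beta)^-1 + eps / (2 * c)) / lam2] /\
  [/\ eta + 4 * chi * l ^+ 2 + eps * (c / 2) * hlamn = v,
      0 <= theta, 0 <= B, a + B * q = theta & b + (1 + eps) * theta = B] /\
  B * (delta / (1 - q)) <=
    c * hlam1 / 2 - l ^+ 2 / eta - 8 * chi * (4 * l ^+ 2 + c ^+ 2 * hlamn ^+ 2).
Proof.
move=> c0 v0 lam20 lamn0 d0 d1 hbeta G G0 hd.
have cn0 : c != 0 by rewrite gt_eqF.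
have beta0 : 0 < beta.
  by apply: le_lt_trans hbeta; rewrite divr_ge0 ?sqr_ge0 // !mulr_ge0 // ltW.
have q1 : 0 < 1 - Num.sqrt delta.
  by rewrite subr_gt0 -[ltRHS]sqrtr1 ltr_sqrt.
set q := Num.sqrt delta in q1 hd *.
pose chi (e : R) := ((8 * c * beta)^-1 + e / (2 * c)) / lam2.
pose eta e := v - 4 * chi e * l ^+ 2 - e * (c / 2) * hlamn.
pose a e := c * lamn / 2 + 4 * chi e * c ^+ 2 * lamn ^+ 2.
pose b e := 2 * c * beta * lamn + 4 * chi e * c ^+ 2 * lamn ^+ 2.
pose D e := 1 - (1 + e) * q.
pose G' e := c * hlam1 / 2 - l ^+ 2 / eta e
  - 8 * chi e * (4 * l ^+ 2 + c ^+ 2 * hlamn ^+ 2).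
pose F e := G' e - (b e + (1 + e) * a e) / D e * (delta / (1 - q)).
have chi00 : chi 0 = (8 * c * beta * lam2)^-1.
  by rewrite /chi mul0r addr0 [RHS]invfM.
have kap0 : 0 < c * beta * lam2 by rewrite !mulr_gt0.
have kapv : 0 < 2 * c * beta * lam2 * v - l ^+ 2.
  move: hbeta; rewrite ltr_pdivrMr ?mulr_gt0 // => hb.
  by rewrite subr_gt0 (lt_le_trans hb) // le_eqVlt; apply/orP; left; apply/eqP; ring.
have nz : [&& c != 0, beta != 0, lam2 != 0 & 2 * c * beta * lam2 * v - l ^+ 2 != 0].
  by rewrite !gt_eqF.
case/and4P: nz => nzc nzb nzl nzk.
have eta0E : eta 0 = (2 * c * beta * lam2 * v - l ^+ 2) / (2 * (c * beta * lam2)).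
  by rewrite /eta chi00 !mul0r subr0; field; rewrite nzb nzl nzc.
have eta00 : 0 < eta 0 by rewrite eta0E divr_gt0 // mulr_gt0.
have D00 : 0 < D 0 by rewrite /D addr0 mul1r.
have F00 : 0 < F 0.
  have Gb : c * hlam1 / 2 - l ^+ 2 / eta 0
      - 8 * chi 0 * (4 * l ^+ 2 + c ^+ 2 * hlamn ^+ 2) = G.
    rewrite /G /Gfun eta0E chi00; field.
    by rewrite nzb nzl nzc nzk.
  rewrite /F /G' Gb subr_gt0 /D addr0 !mul1r.
  have dq : (b 0 + a 0) / (1 - q) * (delta / (1 - q)) =
      (b 0 + a 0) * (delta / (1 - q) ^+ 2).
    by field; rewrite gt_eqF.
  rewrite dq.
  set M := 3 * c * lamn + _ + _ in hd.
  have M0 : 0 < M.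
    by rewrite /M !addr_gt0 // ?divr_gt0 ?mulr_gt0 // ?exprn_gt0.
  have baM : b 0 + a 0 <= M.
    rewrite /b /a chi00 /M.
    have -> : 4 * (8 * c * beta * lam2)^-1 * c ^+ 2 * lamn ^+ 2 =
       c * lamn ^+ 2 / (beta * lam2) / 2.
      by field; rewrite nzb nzl nzc.
    have cl : 0 < c * lamn by rewrite mulr_gt0.
    lra.
  have dge : 0 <= delta / (1 - q) ^+ 2 by rewrite divr_ge0 ?sqr_ge0.
  apply: (le_lt_trans (ler_wpM2r dge baM)).
  by move: hd; rewrite ltr_pdivlMr // mulrC.
have cid : (fun e : R => e) @ (0 : R) --> (0 : R) by exact: cvg_id.
have cchi : chi e @[e --> (0 : R)] --> chi 0.
  by apply: cvgMl; apply: cvgD; [exact: cvg_cst | exact: cvgMl].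
have ceta : eta e @[e --> (0 : R)] --> eta 0.
  apply: cvgB; last by apply: cvgMl; apply: cvgMl.
  apply: cvgB; first exact: cvg_cst.
  by apply: cvgMl; apply: cvgMr.
have cfac k : k + 4 * chi e * c ^+ 2 * lamn ^+ 2 @[e --> (0 : R)] -->
    k + 4 * chi 0 * c ^+ 2 * lamn ^+ 2.
  apply: cvgD; first exact: cvg_cst.
  by apply: cvgMl; apply: cvgMl; apply: cvgMr.
have cD : D e @[e --> (0 : R)] --> D 0.
  apply: cvgB; first exact: cvg_cst.
  by apply: cvgMl; apply: cvgD => //; exact: cvg_cst.
have cF : F e @[e --> (0 : R)] --> F 0.
  apply: cvgB.
    apply: cvgB; last by apply: cvgMl; apply: cvgMr.
    apply: cvgB; first exact: cvg_cst.
    by apply: cvgMr; apply: cvgV => //; rewrite gt_eqF.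
  apply: cvgMl; apply: cvgM; last by apply: cvgV => //; rewrite gt_eqF.
  apply: cvgD; first exact: cfac.
  apply: cvgM; last exact: cfac.
  by apply: cvgD => //; exact: cvg_cst.
have : \forall e \near (0 : R)^'+, [/\ 0 < e, 0 < eta e, 0 < D e & 0 < F e].
  near=> e; split.
  - by near: e; exact: nbhs_right_gt.
  - near: e; apply: cvg_within; exact: (cvgr_gt _ ceta).
  - near: e; apply: cvg_within; exact: (cvgr_gt _ cD).
  - near: e; apply: cvg_within; exact: (cvgr_gt _ cF).
move=> /filter_ex[e [e0 etae De Fe]].
have chi_ge0 : 0 <= chi e.
  apply: divr_ge0; last exact: ltW.
  by apply: addr_ge0; rewrite ?invr_ge0 ?divr_ge0 ?mulr_ge0 // ltW.
have lc0 := ltW c0; have ll0 := ltW lamn0; have lb0 := ltW beta0.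
have q0 : 0 <= q by exact: sqrtr_ge0.
have a0 : 0 <= a e.
  apply: addr_ge0; first by apply: divr_ge0 => //; exact: mulr_ge0.
  by apply: mulr_ge0; [apply: mulr_ge0; [exact: mulr_ge0|]|]; exact: sqr_ge0.
have b0 : 0 <= b e.
  apply: addr_ge0; first by rewrite !mulr_ge0.
  by apply: mulr_ge0; [apply: mulr_ge0; [exact: mulr_ge0|]|]; exact: sqr_ge0.
have e10 : 0 <= 1 + e by rewrite addr_ge0 // ltW.
pose B := (b e + (1 + e) * a e) / D e.
have B0 : 0 <= B by rewrite divr_ge0 ?(ltW De) // addr_ge0 // mulr_ge0.
exists e, (eta e), (chi e), (a e + B * q), B.
split; first by split.
split; last by have := ltW Fe; rewrite subr_ge0.
split=> //.
- by rewrite /eta; ring.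
- by rewrite addr_ge0 // mulr_ge0.
- have De' : 1 - (1 + e) * q != 0 by rewrite gt_eqF.
  by rewrite -/(a e) -/(b e) /B /D; field.
Unshelve. all: by end_near. Qed.
End ParameterChoice.

(** * Spectral bounds for the two Laplacians *)

Section LaplacianSpectrum.
Variables (R : realType) (n : nat) (E : rel 'I_n.+2).
Hypothesis Esym : symmetric E.
Hypothesis conn : connected_graph E.
Local Notation L := (laplacian E R).
Local Notation Lu := (unsigned_laplacian E R).
Variables (lam hlam : n.+2.-tuple R).
Hypothesis lamE : ordered_eigenvalues L lam.
Hypothesis hlamE : ordered_eigenvalues Lu hlam.
Hypothesis Lu_pos : posdef Lu.

Lemma sorted_bounds m (s : m.+1.-tuple R) t : sorted <=%R s -> t \in (s : seq R) ->
  s`_0 <= t <= s`_m.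
Proof.
move=> ss ts; have [i +] := elimT (nthP 0) ts; rewrite size_tuple ltnS => im <-.
by apply/andP; split; apply: (le_sorted_leq_nth 0 ss); rewrite ?inE ?size_tuple ?ltnS.
Qed.

Let sL : L^T = L := laplacian_sym R Esym.
Let lam_ge0 t : t \in (lam : seq R) -> 0 <= t.
Proof. exact: (psd_eigenvalues_ge0 sL lamE (laplacian_psd_col Esym)). Qed.

Lemma lam2_gt0 : 0 < lam`_1.
Proof.
apply: (second_eig_gt0 sL lamE (laplacian_psd_col Esym)) => x Lx i.
exact: laplacian_ker.
Qed.

Lemma lam1_eq0 : lam`_0 = 0.
Proof.
have in0 : 0 \in (lam : seq R).
  rewrite -root_prod_XsubC -lamE.2 -eigenvalue_root_char.
  apply/eigenvalueP; exists (const_mx 1).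
    rewrite scale0r; apply: trmx_inj; rewrite trmx_mul sL trmx_const trmx0.
    exact: laplacian_const.
  by apply/eqP => /rowP/(_ 0); rewrite !mxE => /eqP; rewrite oner_eq0.
have /andP[l0 _] := sorted_bounds lamE.1 in0.
by apply/le_anti; rewrite l0 lam_ge0 // mem_nth // size_tuple.
Qed.

Lemma lam2_le_lamn : lam`_1 <= lam`_n.+1.
Proof. by apply: (le_sorted_leq_nth 0 lamE.1); rewrite ?inE ?size_tuple. Qed.

Variable d : nat.
Implicit Types X : 'M[R]_(n.+2, d).

Lemma laplacian_psd X : 0 <= ip X (L *m X).
Proof.
have := symmetric_quad_ge0 (p0 := 0) (p1 := 1) (p2 := 0) sL lamE _ X.
rewrite !mul0r add0r mul1r addr0; apply => t tl.
by rewrite !mul0r add0r mul1r addr0 lam_ge0.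
Qed.

Lemma laplacian_upper X : ip X (L *m X) <= lam`_n.+1 * ip X X.
Proof.
have := symmetric_quad_ge0 (p0 := lam`_n.+1) (p1 := - 1) (p2 := 0) sL lamE _ X.
rewrite mul0r addr0 mulN1r subr_ge0; apply => t tl.
by rewrite mul0r addr0 mulN1r subr_ge0; case/andP: (sorted_bounds lamE.1 tl).
Qed.

Lemma laplacian_sqr_upper X : ip (L *m X) (L *m X) <= lam`_n.+1 ^+ 2 * ip X X.
Proof.
have := symmetric_quad_ge0 (p0 := lam`_n.+1 ^+ 2) (p1 := 0) (p2 := - 1) sL lamE _ X.
rewrite mul0r addr0 mulN1r subr_ge0; apply => t tl.
rewrite mul0r addr0 mulN1r subr_ge0; case/andP: (sorted_bounds lamE.1 tl) => _ h.
by apply: lerXn2r; rewrite ?nnegrE ?(le_trans _ h) ?lam_ge0.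
Qed.

(** t (t - lam2) >= 0 on the spectrum: t is either the zero eigenvalue or at
    least lam2. *)
Lemma laplacian_gap X : lam`_1 * ip X (L *m X) <= ip (L *m X) (L *m X).
Proof.
have := symmetric_quad_ge0 (p0 := 0) (p1 := - lam`_1) (p2 := 1) sL lamE _ X.
rewrite mul0r add0r mul1r mulNr addrC subr_ge0; apply => t.
move=> tl; have [i +] := elimT (nthP 0) tl; rewrite size_tuple => ilt <-.
rewrite add0r mul1r mulNr addrC expr2 -mulrBl.
case: i ilt => [|i] ilt; first by rewrite lam1_eq0 mulr0.
apply: mulr_ge0; last by apply: lam_ge0; rewrite mem_nth ?size_tuple.
by rewrite subr_ge0; apply: (le_sorted_leq_nth 0 lamE.1); rewrite ?inE ?size_tuple.
Qed.

Let hlam_ge0 t : t \in (hlam : seq R) -> 0 <= t.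
Proof.
apply: (psd_eigenvalues_ge0 Lu_pos.1 hlamE) => x.
have [->|x0] := eqVneq x 0; first by rewrite ip0l.
by rewrite -dotv_ip ltW // Lu_pos.2.
Qed.

Lemma unsigned_lower X : hlam`_0 * ip X X <= ip X (Lu *m X).
Proof.
have := symmetric_quad_ge0 (p0 := - hlam`_0) (p1 := 1) (p2 := 0) Lu_pos.1 hlamE _ X.
rewrite mul0r addr0 mul1r addrC mulNr subr_ge0; apply => t tl.
rewrite mul0r addr0 mul1r addrC subr_ge0.
by case/andP: (sorted_bounds hlamE.1 tl).
Qed.

Lemma unsigned_upper X : ip X (Lu *m X) <= hlam`_n.+1 * ip X X.
Proof.
have := symmetric_quad_ge0 (p0 := hlam`_n.+1) (p1 := - 1) (p2 := 0) Lu_pos.1 hlamE _ X.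
rewrite mul0r addr0 mulN1r subr_ge0; apply => t tl.
by rewrite mul0r addr0 mulN1r subr_ge0; case/andP: (sorted_bounds hlamE.1 tl).
Qed.

Lemma unsigned_sqr_upper X : ip (Lu *m X) (Lu *m X) <= hlam`_n.+1 ^+ 2 * ip X X.
Proof.
have := symmetric_quad_ge0 (p0 := hlam`_n.+1 ^+ 2) (p1 := 0) (p2 := - 1) Lu_pos.1 hlamE _ X.
rewrite mul0r addr0 mulN1r subr_ge0; apply => t tl.
rewrite mul0r addr0 mulN1r subr_ge0; case/andP: (sorted_bounds hlamE.1 tl) => _ h.
by apply: lerXn2r; rewrite ?nnegrE ?(le_trans _ h) ?hlam_ge0.
Qed.
End LaplacianSpectrum.

(** * The iteration in matrix form *)

Section StackedMatrix.
Variables (R : realType) (n d : nat).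

Definition rowsmx (x : 'I_n -> 'cV[R]_d) : 'M[R]_(n, d) := \matrix_(i, a) x i a 0.

Lemma ip_rowsmx x y : ip (rowsmx x) (rowsmx y) = \sum_i ip (x i) (y i).
Proof.
rewrite ipE; apply: eq_bigr => i _; rewrite -dotv_ip.
by apply: eq_bigr => a _; rewrite !mxE.
Qed.

Lemma rowsmxB x y : rowsmx x - rowsmx y = rowsmx (fun i => x i - y i).
Proof. by apply/matrixP => i a; rewrite !mxE. Qed.
End StackedMatrix.

Section EnergyDecrease.
Variables (R : realType) (n d : nat) (E : rel 'I_n.+2).
Variables (f : 'I_n.+2 -> 'cV[R]_d -> R) (v l c : R) (xstar : 'cV[R]_d).
Hypothesis Esym : symmetric E.
Hypothesis conn : connected_graph E.
Hypothesis df : forall i x, differentiable (grad (f i)) x.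
Hypotheses (v_gt0 : 0 < v) (c_gt0 : 0 < c).
Hypothesis sc : forall i, strongly_convex v (f i).
Hypothesis lg : forall i, lipschitz_grad l (f i).
Hypothesis gstar0 : \sum_i grad (f i) xstar = 0.
Local Notation L := (laplacian E R).
Local Notation Lu := (unsigned_laplacian E R).
Implicit Types st : state R n.+2 d.

Lemma shifted_hess_unitmx st i : shifted_hess E f c st i \in unitmx.
Proof.
apply: (shifted_hess_unit (v := v)) => //.
by rewrite !mulr_ge0 // ltW.
Qed.

Definition dev st := rowsmx (fun i => x_ st i - xstar).
Definition err st := rowsmx (fun i => x_ st i - y_ st i).
Definition opt_grad := rowsmx (fun i => grad (f i) xstar).
Definition dual_dev st := (pinvmx L)^T *m (rowsmx (phi_ st) + opt_grad).

Lemma sum_rowsmx (x : 'I_n.+2 -> 'cV[R]_d) :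
  (const_mx 1 : 'rV[R]_n.+2) *m rowsmx x = (\sum_i x i)^T.
Proof.
apply/rowP => a; rewrite !mxE summxE; apply: eq_bigr => i _.
by rewrite !mxE mul1r.
Qed.

Lemma const_mul_laplacian : (const_mx 1 : 'rV[R]_n.+2) *m L = 0.
Proof.
apply: trmx_inj; rewrite trmx_mul (laplacian_sym R Esym).
by rewrite trmx_const (laplacian_const R E) [RHS]trmx0.
Qed.

Lemma rowsmx_laplacian (y : 'I_n.+2 -> 'cV[R]_d) :
  rowsmx (fun i => \sum_(j in nbr E i) (y i - y j)) = L *m rowsmx y.
Proof.
apply/matrixP => i a; rewrite laplacian_mulE mxE summxE.
by apply: eq_bigr => j _; rewrite !mxE.
Qed.

Variables (S : Type) (C : S -> 'cV[R]_d -> 'cV[R]_d) (mu : nat -> R).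
Variables (x0 : 'I_n.+2 -> 'cV[R]_d) (s : 'I_n.+2 -> nat -> S).
Local Notation st k := (ccdqm E f C c mu x0 s k).

Lemma phi_rowsmx k : rowsmx (phi_ (st k.+1)) =
  rowsmx (phi_ (st k)) + c *: (L *m rowsmx (y_ (st k.+1))).
Proof.
rewrite -rowsmx_laplacian; apply/matrixP => i a.
by rewrite mxE phi_step !mxE.
Qed.

Lemma phi_sum0 k : (const_mx 1 : 'rV[R]_n.+2) *m rowsmx (phi_ (st k)) = 0.
Proof.
elim: k => [|k IH].
  by rewrite sum_rowsmx big1 ?trmx0.
by rewrite phi_rowsmx mulmxDr IH -scalemxAr mulmxA const_mul_laplacian mul0mx scaler0 addr0.
Qed.

(** The columns of phi have zero sum because phi is a sum of terms in the range of
    L, and those of the gradients because xstar is a minimizer. *)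
Lemma laplacian_dual_dev k :
  L *m dual_dev (st k) = rowsmx (phi_ (st k)) + opt_grad.
Proof.
apply: range_pinv; first exact: laplacian_sym.
- exact: laplacian_const.
- by move=> x Lx i; exact: (laplacian_ker Esym conn Lx).
by rewrite mulmxDr phi_sum0 add0r sum_rowsmx gstar0 trmx0.
Qed.

Definition grad_dev k := rowsmx (fun i => grad (f i) (x_ (st k) i) - grad (f i) xstar).
Definition newton_residual k := rowsmx (fun i =>
  grad (f i) (x_ (st k) i) - grad (f i) (x_ (st k.+1) i)
  + hess (f i) (y_ (st k) i) *m (x_ (st k.+1) i - x_ (st k) i)).

(** The Newton-type update solved for the step, without the inverse matrix. *)
Lemma update_eq k i : (2 * c * (deg E i)%:R) *: (x_ (st k.+1) i - x_ (st k) i)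
  + hess (f i) (y_ (st k) i) *m (x_ (st k.+1) i - x_ (st k) i)
  = - forcing E f c (st k) i.
Proof.
rewrite x_step /primal_update addrAC subrr add0r.
rewrite -mul_scalar_mx -mulmxDl mulmxN -/(shifted_hess E f c (st k) i).
by rewrite mulmxA mulmxV ?mul1mx // shifted_hess_unitmx.
Qed.

(** The updates of x and phi combined, after replacing y by x - e and 2 deg
    by L + Lu. *)
Lemma optimality_eq k : grad_dev k.+1 + newton_residual k
  + c *: (Lu *m (dev (st k.+1) - dev (st k)))
  - c *: (L *m (err (st k) - err (st k.+1))) + L *m dual_dev (st k.+1) = 0.
Proof.
rewrite laplacian_dual_dev phi_rowsmx.
have devE : dev (st k.+1) - dev (st k) =
    rowsmx (x_ (st k.+1)) - rowsmx (x_ (st k)).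
  by apply/matrixP => i a; rewrite !mxE; ring.
have errE : err (st k) - err (st k.+1) =
    - (rowsmx (x_ (st k.+1)) - rowsmx (x_ (st k)))
    + (rowsmx (y_ (st k.+1)) - rowsmx (y_ (st k))).
  by apply/matrixP => i a; rewrite !mxE; ring.
rewrite devE errE [L *m (- _ + _)]mulmxDr mulmxN [L *m (rowsmx (y_ _) - _)]mulmxBr.
set X := rowsmx (x_ (st k.+1)) - rowsmx (x_ (st k)).
apply/matrixP => i a.
have LuE : (Lu *m X) i a = 2 * (deg E i)%:R * X i a - (L *m X) i a.
  have := congr1 (fun M : 'M[R]_n.+2 => (M *m X) i a) (double_degmx R E).
  rewrite /= mulmxDl -scalemxAl [LHS]mxE [RHS]mxE degmx_mulE => h.
  by apply/eqP; rewrite eq_sym subr_eq addrC -mulrA -h.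
have coordE (b : R) (D u g w p : 'cV[R]_d) : b *: D + u = - (g + c *: w + p) ->
    b * D a 0 + u a 0 = - (g a 0 + c * w a 0 + p a 0).
  by move=> /(congr1 (fun w : 'cV[R]_d => w a 0)); rewrite !mxE.
have up := coordE _ _ _ _ _ _ (update_eq k i).
have Ly : (L *m rowsmx (y_ (st k))) i a =
    (\sum_(j in nbr E i) (y_ (st k) i - y_ (st k) j)) a 0.
  by rewrite -rowsmx_laplacian mxE.
rewrite -Ly in up.
have XE : (x_ (st k.+1) i - x_ (st k) i) a 0 = X i a by rewrite !mxE.
rewrite XE in up.
have sumE (g r LX Y1 Y0 LuX p o : 'M[R]_(n.+2, d)) :
   (g + r + c *: LuX - c *: (- LX + (Y1 - Y0)) + (p + c *: Y1 + o)) i a =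
   g i a + r i a + c * LuX i a - c * (- LX i a + (Y1 i a - Y0 i a))
   + (p i a + c * Y1 i a + o i a) by rewrite !mxE.
rewrite sumE LuE.
have gE : grad_dev k.+1 i a = grad (f i) (x_ (st k.+1) i) a 0 - grad (f i) xstar a 0.
  by rewrite [LHS]mxE [LHS]mxE [X in _ + X]mxE.
have rE : newton_residual k i a = grad (f i) (x_ (st k) i) a 0
    - grad (f i) (x_ (st k.+1) i) a 0
    + (hess (f i) (y_ (st k) i) *m (x_ (st k.+1) i - x_ (st k) i)) a 0.
  by rewrite [LHS]mxE [LHS]mxE [X in X + _ = _]mxE [X in _ + X + _ = _]mxE.
have pE : rowsmx (phi_ (st k)) i a = phi_ (st k) i a 0 by rewrite mxE.
have oE : opt_grad i a = grad (f i) xstar a 0 by rewrite mxE.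
rewrite gE rE pE oE [RHS]mxE; move: up.
move: (X i a) ((hess _ _ *m _) a 0) (grad _ _ a 0) (grad _ _ a 0) (grad _ _ a 0) => *.
lra.
Qed.

Lemma residual_bound k : ip (newton_residual k) (newton_residual k) <=
  4 * l ^+ 2 * ip (dev (st k.+1) - dev (st k)) (dev (st k.+1) - dev (st k)).
Proof.
rewrite rowsmxB !ip_rowsmx mulr_sumr; apply: ler_sum => i _.
set x := x_ (st k) i; set x' := x_ (st k.+1) i.
have -> : x' - xstar - (x - xstar) = x' - x by rewrite opprB addrA subrK.
set g := grad (f i) x - grad (f i) x'; set u := hess _ _ *m _.
have h1 : ip g g <= l ^+ 2 * ip (x' - x) (x' - x).
  have := lipschitz_grad_ip x' x (lg i); rewrite -/g.
  by rewrite -(opprB x' x) ipNl ipNr opprK.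
have h2 : ip u u <= l ^+ 2 * ip (x' - x) (x' - x) by exact: hess_bounded.
have h3 : ip (g + u) (g + u) <= 2 * ip g g + 2 * ip u u.
  move: g u {h1 h2} => g u.
  by have := ip_ge0 (g - u); rewrite !ip_expand (ipC u g); lra.
lra.
Qed.

Lemma grad_dev_monotone k : v * ip (dev (st k)) (dev (st k)) <= ip (grad_dev k) (dev (st k)).
Proof.
rewrite !ip_rowsmx mulr_sumr; apply: ler_sum => i _.
by have := sc i xstar (x_ (st k) i); rewrite enorm_sqr dotv_ip.
Qed.

Lemma grad_dev_bound k : ip (grad_dev k) (grad_dev k) <= l ^+ 2 * ip (dev (st k)) (dev (st k)).
Proof.
rewrite !ip_rowsmx mulr_sumr; apply: ler_sum => i _.
exact: lipschitz_grad_ip.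
Qed.

Lemma dual_step k : L *m dual_dev (st k.+1) =
  L *m dual_dev (st k) + c *: (L *m (dev (st k.+1) - err (st k.+1))).
Proof.
have -> : L *m (dev (st k.+1) - err (st k.+1)) = L *m rowsmx (y_ (st k.+1)).
  have -> : dev (st k.+1) - err (st k.+1) =
      rowsmx (y_ (st k.+1)) - rowsmx (fun=> xstar).
    by apply/matrixP => i a; rewrite !mxE; ring.
  rewrite mulmxBr -[X in _ - X]rowsmx_laplacian.
  have -> : rowsmx (fun i => \sum_(j in nbr E i) (xstar - xstar)) = 0.
    by apply/matrixP => i a; rewrite !mxE big1 ?mxE // => j _; rewrite subrr.
  by rewrite subr0.
by rewrite !laplacian_dual_dev phi_rowsmx addrAC.
Qed.

End EnergyDecrease.

(** * Square integrability of the iterates *)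

Section SquareIntegrable.
Context (R : realType) dT (T : measurableType dT) (P : probability T R).
Implicit Types u w : T -> R.

Definition L2 u := measurable_fun [set: T] u /\ integ P (fun t => u t ^+ 2).

Lemma L2_dom u h : measurable_fun [set: T] u -> (forall t, u t ^+ 2 <= h t) ->
  integ P h -> L2 u.
Proof.
move=> mu uh ih; split=> //; apply: integ_le ih; first exact: measurable_funX.
by move=> t; rewrite ger0_norm ?sqr_ge0.
Qed.

Lemma L2_cst k : L2 (fun=> k).
Proof. by split; [exact: measurable_cst | exact: integ_cst]. Qed.

Lemma L2D u w : L2 u -> L2 w -> L2 (fun t => u t + w t).
Proof.
move=> [mu iu] [mw iw].
apply: (@L2_dom _ (fun t => 2 * u t ^+ 2 + 2 * w t ^+ 2)).
- exact: measurable_funD.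
- by move=> t; have := sqr_ge0 (u t - w t); rewrite sqrrB sqrrD; lra.
- by apply: integD; exact: integZ.
Qed.

Lemma L2Z k u : L2 u -> L2 (fun t => k * u t).
Proof.
move=> [mu iu]; split; first exact: measurable_funM.
by under eq_fun do rewrite exprMn; exact: integZ.
Qed.

Lemma L2_sum (I : Type) (r : seq I) (Pr : pred I) (u : I -> T -> R) :
  (forall i, L2 (u i)) -> L2 (fun t => \sum_(i <- r | Pr i) u i t).
Proof.
move=> su; elim: r => [|i r IH].
  by under eq_fun do rewrite big_nil; exact: L2_cst.
under eq_fun do rewrite big_cons; case: (Pr i) => //.
exact: L2D.
Qed.

Lemma L2M_integ u w : L2 u -> L2 w -> integ P (fun t => u t * w t).
Proof.
move=> [mu iu] [mw iw]; apply: integ_le (integD iu iw).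
  exact: measurable_funM.
move=> t; rewrite ler_norml; apply/andP; split.
  by have := sqr_ge0 (u t + w t); have := sqr_ge0 (u t); have := sqr_ge0 (w t);
     rewrite sqrrD; lra.
by have := sqr_ge0 (u t - w t); have := sqr_ge0 (u t); have := sqr_ge0 (w t);
  rewrite sqrrB; lra.
Qed.

Lemma L2_integ u : L2 u -> integ P u.
Proof.
move=> su; have := L2M_integ (L2_cst 1) su.
by under eq_fun do rewrite mul1r.
Qed.

Definition L2mx m p (X : T -> 'M[R]_(m, p)) := forall i a, L2 (fun t => X t i a).

Lemma L2mx_cst m p (M : 'M[R]_(m, p)) : L2mx (fun=> M).
Proof. by move=> i a; exact: L2_cst. Qed.

Lemma L2mxD m p (X Y : T -> 'M[R]_(m, p)) : L2mx X -> L2mx Y -> L2mx (fun t => X t + Y t).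
Proof. by move=> sX sY i a; under eq_fun do rewrite mxE; exact: L2D. Qed.

Lemma L2mxZ m p k (X : T -> 'M[R]_(m, p)) : L2mx X -> L2mx (fun t => k *: X t).
Proof. by move=> sX i a; under eq_fun do rewrite mxE; exact: L2Z. Qed.

Lemma L2mxB m p (X Y : T -> 'M[R]_(m, p)) : L2mx X -> L2mx Y -> L2mx (fun t => X t - Y t).
Proof.
move=> sX sY; under eq_fun do rewrite -scaleN1r.
by apply: L2mxD => //; exact: L2mxZ.
Qed.

Lemma L2mx_sum m p (I : Type) (r : seq I) (Pr : pred I) (X : I -> T -> 'M[R]_(m, p)) :
  (forall j, L2mx (X j)) -> L2mx (fun t => \sum_(j <- r | Pr j) X j t).
Proof.
move=> sX i a; under eq_fun do rewrite summxE.
by apply: L2_sum => j; exact: sX.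
Qed.

Lemma L2mx_mull m n p (M : 'M[R]_(m, n)) (X : T -> 'M[R]_(n, p)) :
  L2mx X -> L2mx (fun t => M *m X t).
Proof.
move=> sX i a; under eq_fun do rewrite mxE.
by apply: L2_sum => j; exact: L2Z.
Qed.

Lemma L2mx_ip m p (X Y : T -> 'M[R]_(m, p)) : L2mx X -> L2mx Y ->
  integ P (fun t => ip (X t) (Y t)).
Proof.
move=> sX sY; under eq_fun do rewrite ipE.
by apply: integ_sum => i; apply: integ_sum => a; exact: L2M_integ.
Qed.

Lemma L2mx_dom d (Z : T -> 'cV[R]_d) h :
  measurable_fun [set: T] (Z : T -> borel_vec R d) ->
  (forall t, ip (Z t) (Z t) <= h t) -> integ P h -> L2mx Z.
Proof.
move=> /measurable_vecP mZ Zh ih a b; rewrite (ord1 b).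
apply: (L2_dom (mZ a) _ ih) => t; apply: le_trans (Zh t).
rewrite -dotv_ip /dotv (bigD1 a) //= expr2 lerDl.
by apply: sumr_ge0 => j _; exact: sqr_ge0.
Qed.

Lemma L2mx_rowsmx n d (x : T -> 'I_n -> 'cV[R]_d) :
  (forall i, L2mx (fun t => x t i)) -> L2mx (fun t => rowsmx (x t)).
Proof. by move=> sx i a; under eq_fun do rewrite mxE; exact: sx. Qed.

End SquareIntegrable.

Section Iterates.
Variables (R : realType) (n d : nat) (E : rel 'I_n.+2).
Variables (f : 'I_n.+2 -> 'cV[R]_d -> R) (v l c : R) (xstar : 'cV[R]_d).
Hypothesis df : forall i x, differentiable (grad (f i)) x.
Hypotheses (v_gt0 : 0 < v) (c_gt0 : 0 < c).
Hypothesis sc : forall i, strongly_convex v (f i).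
Hypothesis lg : forall i, lipschitz_grad l (f i).
Context (dS : measure_display) (S : measurableType dS) (Q : probability S R).
Variables (C : S -> 'cV[R]_d -> 'cV[R]_d) (delta : R).
Hypothesis delta_ge0 : 0 <= delta.
Hypothesis contr : contractive_compressor Q delta C.
Variables (mu : nat -> R) (x0 : 'I_n.+2 -> 'cV[R]_d).
Hypothesis mu_ge0 : forall k, 0 <= mu k.
Context (dT : measure_display) (T : measurableType dT) (P : probability T R).
Variable xi : 'I_n.+2 -> nat -> T -> S.
Hypothesis fresh : fresh_seeds Q P xi.
Definition run (k : nat) (w : T) := ccdqm E f C c mu x0 (fun i k => xi i k w) k.
Definition run_offset (i : 'I_n.+2) (k : nat) (w : T) :=
  offset E f c C mu x0 (fun i k => xi i k w) k i.
Definition sent_err i k w := x_ (run k w) i - y_ (run k w) i.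

Let unit_sh st i : shifted_hess E f c st i \in unitmx.
Proof. exact: (shifted_hess_unitmx _ df v_gt0 c_gt0 sc). Qed.

Lemma run_measurable k : mstate (run k).
Proof.
have [mxi _ _] := fresh; have [mC _] := contr.
by apply: (mstate_ccdqm mu x0 df unit_sh mC) => i m _; exact: mxi.
Qed.

Lemma run_offset_past_measurable i k :
  measurable_fun [set: g_sigma_algebraType (past_gen xi k)] (run_offset i k : _ -> borel_vec R d).
Proof.
have [mC _] := contr.
have mst : @mstate _ _ _ _ (g_sigma_algebraType (past_gen xi k)) (run k).
  by apply: (mstate_ccdqm mu x0 df unit_sh mC) => j m mk; exact: seed_past_measurable.
apply: mvecB; last by have [] := mst i.
exact: mvec_primal.
Qed.

Lemma run_offset_measurable i k : measurable_fun [set: T] (run_offset i k : _ -> borel_vec R d).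
Proof.
apply: mvecB; last by have [] := run_measurable k i.
by apply: mvec_primal => //; exact: run_measurable.
Qed.

Lemma sent_errE i k w : sent_err i k.+1 w = sent_error C (mu k) (xi i k w) (run_offset i k w).
Proof. exact: error_step. Qed.

Lemma run_offsetE i k w : run_offset i k w = (x_ (run k.+1 w) i - x_ (run k w) i) + sent_err i k w.
Proof. by rewrite /run_offset /offset /sent_err addrA subrK /run x_step. Qed.

Lemma inverse_hess_bound st i (u : 'cV[R]_d) :
  ip (invmx (shifted_hess E f c st i) *m u) (invmx (shifted_hess E f c st i) *m u)
  <= (v ^+ 2)^-1 * ip u u.
Proof.
set A := shifted_hess E f c st i; set w := invmx A *m u.
have Aw : A *m w = u by rewrite mulmxA mulmxV ?mul1mx ?unit_sh.
have h1 : v * ip w w <= ip u w.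
  rewrite -Aw /A /shifted_hess mulmxDl mul_scalar_mx ipDl ipZl.
  have := hess_monotone w (df i (y_ st i)) (sc i).
  have : 0 <= 2 * c * (deg E i)%:R * ip w w by rewrite !mulr_ge0 ?ip_ge0 // ltW.
  lra.
have := ip_ge0 (u - v *: w); rewrite !ip_expand (ipC w u) => h2.
rewrite ler_pdivlMl ?exprn_gt0 //.
have h3 := ler_wpM2l (ltW v_gt0) h1.
lra.
Qed.

Lemma L2mx_grad i (Z : T -> 'cV[R]_d) : measurable_fun [set: T] (Z : T -> borel_vec R d) ->
  L2mx P Z -> L2mx P (fun w => grad (f i) (Z w)).
Proof.
move=> mZ sZ.
apply: (@L2mx_dom _ _ _ _ _ _
  (fun w => 2 * l ^+ 2 * ip (Z w) (Z w) + 2 * ip (grad (f i) 0) (grad (f i) 0))).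
- exact: mvec_grad.
- move=> w; have := lipschitz_grad_ip 0 (Z w) (lg i); rewrite subr0.
  set g := grad _ (Z w); set g0 := grad _ 0.
  have : ip g g <= 2 * ip (g - g0) (g - g0) + 2 * ip g0 g0.
    move: g g0 => g g0.
    by have := ip_ge0 (g - 2 *: g0); rewrite !ip_expand (ipC g0 g); lra.
  lra.
- by apply: integD; [apply: integZ; exact: L2mx_ip | exact: integ_cst].
Qed.

(** The primal step is controlled by the inverse Hessian bound, and the new y is
    the new x minus the compression error, which is square integrable by
    [fresh_error_bound]. *)
Lemma run_L2 k i : [/\ L2mx P (fun w => x_ (run k w) i),
  L2mx P (fun w => y_ (run k w) i) & L2mx P (fun w => phi_ (run k w) i)].
Proof.
elim: k i => [|k IH] i; first by split; exact: L2mx_cst.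
have sx j : L2mx P (fun w => x_ (run k.+1 w) j).
  have [mx _ _] := run_measurable k j; have [sx _ sp] := IH j.
  have sF : L2mx P (fun w => forcing E f c (run k w) j).
    apply: L2mxD => //; apply: L2mxD; first exact: L2mx_grad.
    apply: L2mxZ; apply: L2mx_sum => m; apply: L2mxB; first by have [] := IH j.
    by have [] := IH m.
  have sI : L2mx P (fun w => x_ (run k w) j - x_ (run k.+1 w) j).
    apply: (@L2mx_dom _ _ _ _ _ _ (fun w => (v ^+ 2)^-1 *
      ip (forcing E f c (run k w) j) (forcing E f c (run k w) j))).
    - by apply: mvecB => //; have [] := run_measurable k.+1 j.
    - move=> w; rewrite [x_ (run k.+1 w) j]x_step /primal_update opprB addrCA subrr addr0.
      exact: inverse_hess_bound.
    - by apply: integZ; exact: L2mx_ip.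
  have := L2mxB sx sI; under eq_fun do rewrite opprB addrCA subrr addr0.
  by [].
have sy j : L2mx P (fun w => y_ (run k.+1 w) j).
  have se : L2mx P (sent_err j k.+1).
    have [_ sy _] := IH j.
    have ig : integ P (fun w => ip (run_offset j k w) (run_offset j k w)).
      by rewrite /run_offset /offset; under eq_fun do rewrite -x_step;
        apply: L2mx_ip; apply: L2mxB => //; exact: sx.
    have [ie _] := fresh_error_bound fresh delta_ge0 contr j (mu_ge0 k)
      (@run_offset_past_measurable j k) (@run_offset_measurable j k) ig.
    apply: (@L2mx_dom _ _ _ _ _ _ (fun w => ip (sent_err j k.+1 w) (sent_err j k.+1 w))) => //.
      by have [mx my _] := run_measurable k.+1 j; exact: mvecB.
    by under eq_fun do rewrite !sent_errE; exact: ie.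
  have := L2mxB (sx j) se; under eq_fun do rewrite opprB addrCA subrr addr0.
  by [].
split=> //; have [_ _ sp] := IH i.
under eq_fun do rewrite /run phi_step.
by apply: L2mxD => //; apply: L2mxZ; apply: L2mx_sum => m; exact: L2mxB.
Qed.

End Iterates.

(** * Mean-square recursion *)

Section Recursion.
Variables (R : realType) (n d : nat) (E : rel 'I_n.+2).
Variables (f : 'I_n.+2 -> 'cV[R]_d -> R) (v l c : R) (xstar : 'cV[R]_d).
Hypothesis Esym : symmetric E.
Hypothesis conn : connected_graph E.
Hypothesis df : forall i x, differentiable (grad (f i)) x.
Hypotheses (v_gt0 : 0 < v) (c_gt0 : 0 < c).
Hypothesis sc : forall i, strongly_convex v (f i).
Hypothesis lg : forall i, lipschitz_grad l (f i).
Hypothesis gstar0 : \sum_i grad (f i) xstar = 0.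
Local Notation L := (laplacian E R).
Local Notation Lu := (unsigned_laplacian E R).
Variables (lam hlam : n.+2.-tuple R).
Hypothesis lamE : ordered_eigenvalues L lam.
Hypothesis hlamE : ordered_eigenvalues Lu hlam.
Hypothesis Lu_pos : posdef Lu.
Context (dS : measure_display) (S : measurableType dS) (Q : probability S R).
Variables (C : S -> 'cV[R]_d -> 'cV[R]_d) (delta : R).
Hypotheses (delta_ge0 : 0 <= delta) (delta_lt1 : delta < 1).
Hypothesis contr : contractive_compressor Q delta C.
Variable (beta : R).
Hypothesis beta_gt0 : 0 < beta.
Local Notation lam2 := (lam`_1).
Local Notation lamn := (lam`_n.+1).
Local Notation hlam1 := (hlam`_0).
Local Notation hlamn := (hlam`_n.+1).
Local Notation q := (Num.sqrt delta).

Variables (eps eta chi theta B : R).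
Let a := c * lamn / 2 + 4 * chi * c ^+ 2 * lamn ^+ 2.
Let b := 2 * c * beta * lamn + 4 * chi * c ^+ 2 * lamn ^+ 2.
Let G' := c * hlam1 / 2 - l ^+ 2 / eta - 8 * chi * (4 * l ^+ 2 + c ^+ 2 * hlamn ^+ 2).
Hypotheses (eps_gt0 : 0 < eps) (eta_gt0 : 0 < eta).
Hypothesis chiE : chi = ((8 * c * beta)^-1 + eps / (2 * c)) / lam2.
Hypothesis etaE : eta + 4 * chi * l ^+ 2 + eps * (c / 2) * hlamn = v.
Hypotheses (theta_ge0 : 0 <= theta) (B_ge0 : 0 <= B).
Hypothesis thetaE : a + B * q = theta.
Hypothesis BE : b + (1 + eps) * theta = B.
Hypothesis BG : B * (delta / (1 - q)) <= G'.

Section Run.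
Variables (mu : nat -> R) (x0 : 'I_n.+2 -> 'cV[R]_d).
Hypothesis mu_ge0 : forall k, 0 <= mu k.
Context (dT : measure_display) (T : measurableType dT) (P : probability T R).
Variable xi : 'I_n.+2 -> nat -> T -> S.
Hypothesis fresh : fresh_seeds Q P xi.
Local Notation st k w := (run E f c C mu x0 xi k w).

Definition energy_at k w := energy L Lu c (dev xstar (st k w)) (dual_dev E f xstar (st k w)).
Definition step_at k w := dev xstar (st k.+1 w) - dev xstar (st k w).
Definition error_at k w := err (st k w).

Lemma energy_decrease k w : (1 + eps) * energy_at k.+1 w + G' * ip (step_at k w) (step_at k w) <=
  energy_at k w + a * ip (error_at k w) (error_at k w) + b * ip (error_at k.+1 w) (error_at k.+1 w).
Proof.
apply: (lyapunov_step (laplacian_sym R Esym) Lu_pos.1 c_gt0 beta_gt0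
  (lam2_gt0 Esym conn lamE) (laplacian_psd Esym lamE (d := d))
  (laplacian_upper Esym lamE (d := d)) (laplacian_sqr_upper Esym lamE (d := d))
  (laplacian_gap Esym lamE (d := d)) (unsigned_lower hlamE Lu_pos (d := d))
  (unsigned_upper hlamE Lu_pos (d := d)) (unsigned_sqr_upper hlamE Lu_pos (d := d))
  (optimality_eq Esym conn df v_gt0 c_gt0 sc gstar0 C mu x0 (fun i k => xi i k w) k)
  _ _ _ _ (ltW eps_gt0) eta_gt0 chiE etaE).
- exact: dual_step.
- exact: grad_dev_monotone.
- exact: grad_dev_bound.
- exact: residual_bound.
Qed.

Let run_l2 := run_L2 E df v_gt0 c_gt0 sc lg delta_ge0 contr x0 mu_ge0 fresh.

Lemma L2mx_dev k : L2mx P (fun w => dev xstar (st k w)).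
Proof.
apply: L2mx_rowsmx => i; apply: L2mxB; last exact: L2mx_cst.
by have [] := run_l2 k i.
Qed.

Lemma L2mx_error_at k : L2mx P (error_at k).
Proof.
apply: L2mx_rowsmx => i; apply: L2mxB; by have [] := run_l2 k i.
Qed.

Lemma L2mx_dual_dev k : L2mx P (fun w => dual_dev E f xstar (st k w)).
Proof.
apply: L2mx_mull; apply: L2mxD; last exact: L2mx_cst.
by apply: L2mx_rowsmx => i; have [] := run_l2 k i.
Qed.

Lemma L2mx_step_at k : L2mx P (step_at k).
Proof. by apply: L2mxB; exact: L2mx_dev. Qed.

Lemma integ_energy_at k : integ P (energy_at k).
Proof.
have sd := L2mx_dev k; have sp := L2mx_dual_dev k.
by apply: integD; apply: integZ; (apply: L2mx_ip => //); exact: L2mx_mull.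
Qed.

Definition mean_error k := Ex P (fun w => ip (error_at k w) (error_at k w)).
Definition mean_step k := Ex P (fun w => ip (step_at k w) (step_at k w)).

Lemma q_lt1 : q < 1.
Proof. by rewrite -[ltRHS]sqrtr1 ltr_sqrt. Qed.

(** The compressed vector is D + e.  With delta = q^2, the bound
    q^2 |D + e|^2 <= q^2 / (1 - q) |D|^2 + q |e|^2 is the nonnegativity of
    |q D - (1 - q) e|^2, up to the factor q / (1 - q). *)
Lemma compression_recursion k :
  mean_error k.+1 <= q * mean_error k + delta / (1 - q) * mean_step k + n.+2%:R * mu k ^+ 2.
Proof.
have q1 := q_lt1; have q0 : 0 <= q by exact: sqrtr_ge0.
have q1' : 0 < 1 - q by rewrite subr_gt0.
have dq : delta = q ^+ 2 by rewrite sqr_sqrtr.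
have see i k' : L2mx P (sent_err E f c C mu x0 xi i k').
  by apply: L2mxB; have [] := run_l2 k' i.
pose Dl i k' w := x_ (st k'.+1 w) i - x_ (st k' w) i.
have sD i k' : L2mx P (Dl i k').
  by apply: L2mxB; [have [] := run_l2 k'.+1 i | have [] := run_l2 k' i].
have eeE k' : mean_error k' = \sum_i Ex P (fun w =>
    ip (sent_err E f c C mu x0 xi i k' w) (sent_err E f c C mu x0 xi i k' w)).
  rewrite -Ex_sum; last by move=> i; exact: L2mx_ip.
  by rewrite /mean_error; under eq_fun do rewrite ip_rowsmx.
have rrE : mean_step k = \sum_i Ex P (fun w => ip (Dl i k w) (Dl i k w)).
  rewrite -Ex_sum; last by move=> i; exact: L2mx_ip.
  rewrite /mean_step; congr Ex; apply/funext => w.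
  rewrite /step_at rowsmxB ip_rowsmx; apply: eq_bigr => i _.
  by congr ip; rewrite opprB addrA subrK.
rewrite !eeE rrE.
have -> : n.+2%:R * mu k ^+ 2 = \sum_(i < n.+2) mu k ^+ 2.
  by rewrite sumr_const card_ord mulr_natl.
rewrite !mulr_sumr -!big_split /=; apply: ler_sum => i _.
have sg : L2mx P (run_offset E f c C mu x0 xi i k).
  have -> : run_offset E f c C mu x0 xi i k = (fun w => Dl i k w + sent_err E f c C mu x0 xi i k w).
    by apply/funext => w; exact: run_offsetE.
  exact: L2mxD.
have [_ le] := fresh_error_bound fresh delta_ge0 contr i (mu_ge0 k)
  (@run_offset_past_measurable _ _ _ _ _ _ _ df v_gt0 c_gt0 sc _ _ _ _ _ contr mu x0 _ _ xi i k)
  (@run_offset_measurable _ _ _ _ _ _ _ df v_gt0 c_gt0 sc _ _ _ _ _ contr mu x0 _ _ _ _ fresh i k)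
  (L2mx_ip sg sg).
have -> : Ex P (fun w =>
    ip (sent_err E f c C mu x0 xi i k.+1 w) (sent_err E f c C mu x0 xi i k.+1 w))
  = Ex P (fun w => ip (sent_error C (mu k) (xi i k w) (run_offset E f c C mu x0 xi i k w))
       (sent_error C (mu k) (xi i k w) (run_offset E f c C mu x0 xi i k w))).
  by congr Ex; apply/funext => w; rewrite sent_errE.
apply: (le_trans le); rewrite lerD2r -!ExZ; try exact: L2mx_ip.
rewrite -ExD; try by apply: integZ; exact: L2mx_ip.
apply: le_Ex.
- by apply: integZ; exact: L2mx_ip.
- by apply: integD; apply: integZ; exact: L2mx_ip.
move=> w; rewrite run_offsetE -/(Dl i k w); set D := Dl i k w.
set s := sent_err _ _ _ _ _ _ _ _ _ _.
move: D s => D s.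
move: q0 q1' dq; move: (q) => r r0 r1 ->.
have := ip_ge0 (r *: D - (1 - r) *: s); rewrite !ip_expand (ipC s D) => h.
rewrite -(ler_pM2l r1).
have h2 := ler_wpM2l r0 h.
have -> : (1 - r) * (r * ip s s + r ^+ 2 / (1 - r) * ip D D) =
   (1 - r) * r * ip s s + r ^+ 2 * ip D D by field; rewrite gt_eqF.
lra.
Qed.

Definition lyapunov k := Ex P (energy_at k) + theta * mean_error k.

(** The primal part of the energy dominates |z|^2, since Lu is bounded below by its
    smallest eigenvalue; the dual part and the error term are nonnegative. *)
Lemma dev_le_lyapunov k : c * hlam1 / 2 *
  Ex P (fun w => ip (dev xstar (st k w)) (dev xstar (st k w))) <= lyapunov k.
Proof.
have id := L2mx_ip (L2mx_dev k) (L2mx_dev k).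
rewrite -(ExZ _ id) /lyapunov.
apply: (@le_trans _ _ (Ex P (energy_at k))); last first.
  by rewrite lerDl mulr_ge0 //; apply: Ex_ge0 => w; exact: ip_ge0.
apply: le_Ex => [||w]; [exact: integZ | exact: integ_energy_at | rewrite /energy_at /energy].
have h1 := ler_wpM2l (ltW c_gt0) (unsigned_lower hlamE Lu_pos (dev xstar (st k w))).
have h2 : 0 <= (2 * c)^-1 * ip (dual_dev E f xstar (st k w)) (L *m dual_dev E f xstar (st k w)).
  apply: mulr_ge0; last exact: (laplacian_psd Esym lamE).
  by rewrite invr_ge0 mulr_ge0 // ltW.
lra.
Qed.

Lemma lyapunov_recursion k : (1 + eps) * lyapunov k.+1 <= lyapunov k + B * (n.+2%:R * mu k ^+ 2).
Proof.
have h1 : (1 + eps) * Ex P (energy_at k.+1) + G' * mean_step k <=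
    Ex P (energy_at k) + a * mean_error k + b * mean_error k.+1.
  have iV1 := integZ (1 + eps) (integ_energy_at k.+1).
  have iD := integZ G' (L2mx_ip (L2mx_step_at k) (L2mx_step_at k)).
  have ie0 := integZ a (L2mx_ip (L2mx_error_at k) (L2mx_error_at k)).
  have ie1 := integZ b (L2mx_ip (L2mx_error_at k.+1) (L2mx_error_at k.+1)).
  have iVe := integD (integ_energy_at k) ie0.
  have := le_Ex (integD iV1 iD) (integD iVe ie1) (energy_decrease k).
  rewrite (ExD iV1 iD) (ExD iVe ie1) (ExD (integ_energy_at k) ie0).
  rewrite (ExZ _ (integ_energy_at k.+1)) (ExZ G' (L2mx_ip (L2mx_step_at k) (L2mx_step_at k))).
  by rewrite (ExZ a (L2mx_ip (L2mx_error_at k) (L2mx_error_at k)))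
    (ExZ b (L2mx_ip (L2mx_error_at k.+1) (L2mx_error_at k.+1))).
have h2 := ler_wpM2l B_ge0 (compression_recursion k).
have r0 : 0 <= mean_step k by apply: Ex_ge0 => w; exact: ip_ge0.
have h3 := ler_wpM2r r0 BG.
have h4 : (a + B * q) * mean_error k = theta * mean_error k by rewrite thetaE.
have h5 : (b + (1 + eps) * theta) * mean_error k.+1 = B * mean_error k.+1 by rewrite BE.
rewrite /lyapunov; move: h1 h2 h3 h4 h5.
move: (Ex P (energy_at k)) (Ex P (energy_at k.+1)) (mean_error k) (mean_error k.+1)
  (mean_step k) (n.+2%:R * mu k ^+ 2)
  (delta / (1 - q)) (q) (a) (b) (G') => V0 V1 p0 p1 r m dd q' a' b' g h1 h2 h3 h4 h5.
lra.
Qed.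

End Run.
End Recursion.

(** * Linear rate *)

Section Stack.
Variables (R : realType) (n d : nat).

Lemma ip_stack (x y : 'I_n -> 'cV[R]_d) : ip (stack x) (stack y) = \sum_i ip (x i) (y i).
Proof.
rewrite /ip tr_mxcol mul_mxrow_mxcol raddf_sum.
by apply: eq_bigr.
Qed.

Lemma stackB (x y : 'I_n -> 'cV[R]_d) : stack x - stack y = stack (fun i => x i - y i).
Proof. by apply/matrixP => i j; rewrite !mxE. Qed.

Context (dT : measure_display) (T : measurableType dT) (P : probability T R).

Lemma expectation_stack (x : T -> 'I_n -> 'cV[R]_d) :
  vec_expectation P (fun w => stack (x w)) =
  stack (fun i => vec_expectation P (fun w => x w i)).
Proof.
apply/colP => s; rewrite !mxE; congr fine.
by congr expectation; apply/funext => w; rewrite mxE.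
Qed.

(** Jensen's inequality, coordinate by coordinate. *)
Lemma expectation_error (x : T -> 'I_n -> 'cV[R]_d) (y : 'cV[R]_d) :
  (forall i, L2mx P (fun w => x w i)) ->
  enorm (vec_expectation P (fun w => stack (x w)) - stack (fun=> y)) ^+ 2 <=
  Ex P (fun w => ip (rowsmx (fun i => x w i - y)) (rowsmx (fun i => x w i - y))).
Proof.
move=> sx; rewrite enorm_sqr expectation_stack stackB ip_stack.
have sxy i : L2mx P (fun w => x w i - y) by apply: L2mxB => //; exact: L2mx_cst.
have -> : (fun w => ip (rowsmx (fun i => x w i - y)) (rowsmx (fun i => x w i - y))) =
    (fun w => \sum_i \sum_a ((x w i - y) a 0) ^+ 2).
  apply/funext => w; rewrite ip_rowsmx; apply: eq_bigr => i _.
  by rewrite -dotv_ip; apply: eq_bigr => a _; rewrite expr2.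
have isq i a : integ P (fun w => (x w i - y) a 0 ^+ 2) by have [] := sxy i a 0.
rewrite Ex_sum; last by move=> i; exact: integ_sum.
apply: ler_sum => i _; rewrite -dotv_ip Ex_sum; last by move=> a; exact: isq.
apply: ler_sum => a _.
have -> : (vec_expectation P (fun w => x w i) - y) a 0 = Ex P (fun w => (x w i - y) a 0).
  have ix := L2_integ (sx i a 0).
  have -> : (fun w => (x w i - y) a 0) = (fun w => x w i a 0 + (- y a 0)).
    by apply/funext => w; rewrite !mxE.
  rewrite (ExD ix (integ_cst P _)) Ex_cst !mxE.
  by rewrite unlock.
rewrite -expr2; apply: Ex_sqr => //; exact: L2_integ (sxy i a 0).
Qed.

Lemma vec_integrable_stack (x : T -> 'I_n -> 'cV[R]_d) :
  (forall i, L2mx P (fun w => x w i)) -> vec_integrable P (fun w => stack (x w)).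
Proof.
move=> sx s; under eq_fun do rewrite mxE.
exact: L2_integ (sx _ _ _).
Qed.
End Stack.

(** The constant A is such that r A + K M <= s^2 A; the strict inequality r < s^2
    makes this possible. *)
Lemma geometric_recursion (R : realType) (u m : nat -> R) (r s t K M : R) :
  0 <= r -> r < s ^+ 2 -> 0 <= s -> s <= t -> 0 <= K -> 0 <= M ->
  (forall k, u k.+1 <= r * u k + K * m k) -> (forall k, m k <= M * (t ^+ k) ^+ 2) ->
  exists2 A, 0 <= A & forall k, u k <= A * (t ^+ k) ^+ 2.
Proof.
move=> r0 rs s0 st K0 M0 ur mM.
have rs' : 0 < s ^+ 2 - r by rewrite subr_gt0.
have KM : 0 <= K * M / (s ^+ 2 - r) by rewrite divr_ge0 ?mulr_ge0 // ltW.
pose A := `|u 0%N| + K * M / (s ^+ 2 - r).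
have A0 : 0 <= A by rewrite addr_ge0.
exists A => //; elim=> [|k IH].
  rewrite expr0 expr1n mulr1; apply: (le_trans (ler_norm _)).
  by rewrite lerDl.
apply: (le_trans (ur k)).
have h1 := ler_wpM2l r0 IH; have h2 := ler_wpM2l K0 (mM k).
rewrite (exprS t k) exprMn.
set p := (t ^+ k) ^+ 2 in h1 h2 *; have p0 : 0 <= p by exact: sqr_ge0.
have h3 : s ^+ 2 <= t ^+ 2 by rewrite lerXn2r ?nnegrE // (le_trans s0).
have h4 : K * M <= A * (s ^+ 2 - r).
  by rewrite /A mulrDl mulfVK ?gt_eqF // lerDr mulr_ge0 // (ltW rs').
have h5 := ler_wpM2r p0 h4.
have h6 := ler_wpM2r p0 (ler_wpM2l A0 h3).
lra.
Qed.

Section Rate.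
Variables (R : realType) (n d : nat) (E : rel 'I_n.+2).
Variables (f : 'I_n.+2 -> 'cV[R]_d -> R) (v l c : R) (xstar : 'cV[R]_d).
Hypothesis Esym : symmetric E.
Hypothesis conn : connected_graph E.
Hypothesis df : forall i x, differentiable (grad (f i)) x.
Hypotheses (v_gt0 : 0 < v) (c_gt0 : 0 < c).
Hypothesis sc : forall i, strongly_convex v (f i).
Hypothesis lg : forall i, lipschitz_grad l (f i).
Hypothesis gstar0 : \sum_i grad (f i) xstar = 0.
Variables (lam hlam : n.+2.-tuple R).
Hypothesis lamE : ordered_eigenvalues (laplacian E R) lam.
Hypothesis hlamE : ordered_eigenvalues (unsigned_laplacian E R) hlam.
Hypothesis Lu_pos : posdef (unsigned_laplacian E R).
Context (dS : measure_display) (S : measurableType dS) (Q : probability S R).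
Variables (C : S -> 'cV[R]_d -> 'cV[R]_d) (delta : R).
Hypotheses (delta_ge0 : 0 <= delta) (delta_lt1 : delta < 1).
Hypothesis contr : contractive_compressor Q delta C.
Variable (beta : R).
Local Notation lam2 := (lam`_1).
Local Notation lamn := (lam`_n.+1).
Local Notation G := (Gfun c v l lam2 hlam`_0 hlam`_n.+1 beta).
Hypothesis beta_large : l ^+ 2 / (2 * c * lam2 * v) < beta.
Hypothesis G_gt0 : 0 < G.
Hypothesis delta_small : delta / (1 - Num.sqrt delta) ^+ 2 <
    G / (3 * c * lamn + 2 * c * beta * lamn + c * lamn ^+ 2 / (beta * lam2)).

(** One sigma serves all thresholds: it depends only on the contraction factor
    1 / (1 + eps). *)
Lemma linear_rate : exists sigma : R, [/\ 0 < sigma, sigma < 1 &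
  forall (mu : nat -> R) (tau M : R), sigma <= tau -> 0 <= M ->
    (forall k, 0 <= mu k) -> (forall k, mu k ^+ 2 <= M * (tau ^+ k) ^+ 2) ->
    ccdqm_linear_rate E f xstar Q C c mu tau].
Proof.
have l20 := lam2_gt0 Esym conn lamE.
have ln0 := lt_le_trans l20 (lam2_le_lamn lamE).
have beta0 : 0 < beta.
  apply: le_lt_trans beta_large; apply: divr_ge0; first exact: sqr_ge0.
  by rewrite !mulr_ge0 // ltW.
have [eps [eta [chi [theta [B [[eps0 eta0 chiE] [[etaE th0 B0 thE BE] BG]]]]]]] :=
  parameter_choice c_gt0 v_gt0 l20 ln0 delta_ge0 delta_lt1 beta_large G_gt0 delta_small.
have hl0 : 0 < hlam`_0.
  have kv : 0 < 2 * c * beta * lam2 * v - l ^+ 2.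
    move: beta_large; rewrite ltr_pdivrMr ?mulr_gt0 // => hb.
    by rewrite subr_gt0 (lt_le_trans hb) // le_eqVlt; apply/orP; left; apply/eqP; ring.
  have t1 : 0 <= 2 * c * beta * lam2 * l ^+ 2 / (2 * c * beta * lam2 * v - l ^+ 2).
    apply: divr_ge0; last exact: ltW.
    by apply: mulr_ge0; [rewrite !mulr_ge0 // ltW | exact: sqr_ge0].
  have t2 : 0 <= (c ^+ 2 * hlam`_n.+1 ^+ 2 + 4 * l ^+ 2) / (c * beta * lam2).
    apply: divr_ge0; last by rewrite !mulr_ge0 // ltW.
    by apply: addr_ge0; apply: mulr_ge0; rewrite ?sqr_ge0.
  have : 0 < c * hlam`_0 / 2 by move: G_gt0; rewrite /Gfun; lra.
  by rewrite pmulr_lgt0 ?invr_gt0 // pmulr_rgt0.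
(* The midpoint of r and 1 satisfies sigma^2 > r, by (1 - r)^2 > 0. *)
pose r := (1 + eps)^-1; pose sigma := (1 + r) / 2.
have e1 : 0 < 1 + eps by rewrite addr_gt0.
have r0 : 0 < r by rewrite invr_gt0.
have r1 : r < 1 by rewrite invf_lt1 // ltrDl.
have s0 : 0 < sigma by rewrite divr_gt0 // addr_gt0.
have s1 : sigma < 1 by rewrite /sigma; lra.
have rs : r < sigma ^+ 2.
  have := exprn_gt0 2 (_ : 0 < 1 - r); rewrite subr_gt0 r1 => /(_ isT).
  rewrite /sigma expr_div_n sqrrB sqrrD !expr1n; lra.
exists sigma; split=> // mu tau M st M0 mu0 muM.
have tau0 : 0 <= tau by rewrite (le_trans _ st) // ltW.
move=> dT T P xi x0 fresh X.
have rl2 := run_L2 E df v_gt0 c_gt0 sc lg delta_ge0 contr x0 mu0 fresh.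
have sX k i : L2mx P (fun w => x_ (run E f c C mu x0 xi k w) i) by have [] := rl2 k i.
split; first by move=> k; exact: (vec_integrable_stack (sX k)).
have Urec := lyapunov_recursion Esym conn df v_gt0 c_gt0 sc lg gstar0 lamE hlamE Lu_pos
  delta_ge0 delta_lt1 contr beta0 eps0 eta0 chiE etaE B0 thE BE BG x0 mu0 fresh.
set u := lyapunov _ _ _ _ _ _ _ _ _ _ in Urec.
have [A A0 uA] : exists2 A, 0 <= A & forall k, u k <= A * (tau ^+ k) ^+ 2.
  apply: (@geometric_recursion _ u (fun k => mu k ^+ 2) r sigma tau (r * B * n.+2%:R) M) => //.
  - exact: ltW.
  - exact: ltW.
  - by rewrite !mulr_ge0 // ltW.
  have er : (1 + eps) * r = 1 by rewrite mulfV // gt_eqF.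
  move=> k; rewrite -(ler_pM2l e1) (mulrDr _ (r * u k)) !mulrA er !mul1r.
  by apply: le_trans (Urec k) _; rewrite !mulrA.
pose K := 2 / (c * hlam`_0) * A.
have ch : 0 < c * hlam`_0 by rewrite mulr_gt0.
have K0 : 0 <= K by rewrite mulr_ge0 // divr_ge0 // ltW.
have bound k : enorm (vec_expectation P (X k) - stack (fun=> xstar)) ^+ 2 <=
    K * (tau ^+ k) ^+ 2.
  apply: (le_trans (expectation_error xstar (sX k))).
  have ch2 : 0 < c * hlam`_0 / 2 by rewrite divr_gt0.
  have dU := dev_le_lyapunov xstar Esym df v_gt0 c_gt0 sc lg
    lamE hlamE Lu_pos delta_ge0 contr th0 x0 mu0 fresh k.
  rewrite -(ler_pM2l ch2); apply: (le_trans (le_trans dU (uA k))).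
  rewrite /K le_eqVlt; apply/orP; left; apply/eqP; field.
  by rewrite !gt_eqF.
apply/eqO_exP; exists (Num.sqrt K + 1); first by apply: ltr_wpDl; rewrite ?sqrtr_ge0 ?ltr01.
near=> k.
rewrite ger0_norm ?sqrtr_ge0 // ger0_norm ?exprn_ge0 //.
apply: (@le_trans _ _ (Num.sqrt K * tau ^+ k)); last first.
  by rewrite ler_wpM2r ?exprn_ge0 // lerDl.
rewrite -(@ler_pXn2r _ 2) ?nnegrE ?mulr_ge0 ?sqrtr_ge0 ?exprn_ge0 //.
by rewrite exprMn (sqr_sqrtr K0).
Unshelve. all: by end_near. Qed.
End Rate.

Lemma minI_gt0 (R : realType) n (v : 'I_n.+1 -> R) : (forall i, 0 < v i) -> 0 < minI v.
Proof. by move=> v0; apply: lt_bigmin. Qed.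

(** This excludes the graph with one vertex, for which there is no second
    eigenvalue. *)
Lemma unsigned_laplacian1_not_posdef (R : realType) (E : rel 'I_1) :
  irreflexive E -> ~ posdef (unsigned_laplacian E R).
Proof.
move=> Eirr [_ /(_ (const_mx 1))].
have -> : unsigned_laplacian E R = 0.
  apply/matrixP => i j; rewrite !ord1 !mxE Eirr /deg.
  by rewrite eq_card0 ?mul0rn ?addr0 // => k; rewrite !inE ord1 Eirr.
rewrite mul0mx dotv_ip ipC ip0l ltxx => h; suff /h: const_mx 1 != 0 :> 'cV[R]_1 by [].
by apply/eqP => /colP/(_ 0); rewrite !mxE => /eqP; rewrite oner_eq0.
Qed.

Theorem theorem2 (R : realType) (n d : nat)
  (f : 'I_n.+1 -> 'cV[R]_d -> R) (v_ l_ : 'I_n.+1 -> R)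
  (f_diff : forall i, twice_differentiable (f i))
  (v_gt0 : forall i, 0 < v_ i)
  (f_convex : forall i, strongly_convex (v_ i) (f i))
  (f_lipschitz : forall i, lipschitz_grad (l_ i) (f i))
  (xstar : 'cV[R]_d)
  (xstar_min : is_minimizer (fun x => \sum_(i < n.+1) f i x) xstar)
  (E : rel 'I_n.+1)
  (E_irr : irreflexive E) (E_undirected : symmetric E)
  (E_connected : connected_graph E)
  (Lu_posdef : posdef (unsigned_laplacian E R))
  (lam hlam : n.+1.-tuple R)
  (lamE : ordered_eigenvalues (laplacian E R) lam)
  (hlamE : ordered_eigenvalues (unsigned_laplacian E R) hlam)
  (dS : measure_display) (S : measurableType dS) (Q : probability S R)
  (C : S -> 'cV[R]_d -> 'cV[R]_d) (delta : R)
  (delta_ge0 : 0 <= delta) (delta_lt1 : delta < 1)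
  (C_contr : contractive_compressor Q delta C)
  (c beta : R) (c_gt0 : 0 < c) :
  let v := minI v_ in
  let l := maxI l_ in
  let lam2 := lam`_1 in
  let lamn := lam`_n in
  let G := Gfun c v l lam2 hlam`_0 hlam`_n in
  l ^+ 2 / (2 * c * lam2 * v) < beta ->
  0 < G beta ->
  delta / (1 - Num.sqrt delta) ^+ 2 <
    G beta / (3 * c * lamn + 2 * c * beta * lamn
              + c * lamn ^+ 2 / (beta * lam2)) ->
  exists sigma : R,
    [/\ 0 < sigma, sigma < 1,
        ccdqm_linear_rate E f xstar Q C c (fun=> 0) sigma
      & forall alpha rho : R, 0 < alpha -> 0 < rho -> rho < 1 ->
          ccdqm_linear_rate E f xstar Q C c
            (fun k => alpha * rho ^ (k%:Z - 1)) (Num.max sigma rho)].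
Proof.
move=> v l lam2 lamn G hbeta G0 hd.
case: n => [|n] in f v_ l_ f_diff v_gt0 f_convex f_lipschitz xstar_min E E_irr
  E_undirected E_connected Lu_posdef lam hlam lamE hlamE v l lam2 lamn G hbeta G0 hd *.
  by case: (unsigned_laplacian1_not_posdef E_irr Lu_posdef).
have v0 : 0 < v by exact: minI_gt0.
have sc i : strongly_convex v (f i).
  move=> x x'; apply: le_trans (f_convex i x x').
  by rewrite ler_wpM2r ?sqr_ge0 // bigmin_le.
have lg i : lipschitz_grad l (f i).
  move=> x x'; apply: (le_trans (f_lipschitz i x x')).
  by rewrite ler_wpM2r ?sqrtr_ge0 // le_bigmax.
have df i x : differentiable (grad (f i)) x by have [] := f_diff i.
have gstar0 : \sum_i grad (f i) xstar = 0.
  by apply: sum_grad_minimizer xstar_min => i; have [] := f_diff i.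
have [sigma [s0 s1 rate]] := linear_rate E_undirected E_connected df v0 c_gt0
  sc lg gstar0 lamE hlamE Lu_posdef delta_ge0 delta_lt1 C_contr hbeta G0 hd.
exists sigma; split=> //.
  apply: (rate _ _ 0) => // k.
  by rewrite expr2 mul0r mul0r.
move=> alpha rho a0 r0 r1.
apply: (rate _ _ ((alpha / rho) ^+ 2)).
- by rewrite le_max lexx.
- exact: sqr_ge0.
- by move=> k; rewrite mulr_ge0 ?exprz_ge0 // ltW.
move=> k; have -> : alpha * rho ^ (k%:Z - 1) = alpha / rho * rho ^+ k.
  by rewrite expfzDr ?gt_eqF // -exprnP exprN1 [_ ^+ k * _]mulrC mulrA.
rewrite exprMn ler_wpM2l ?sqr_ge0 //.
have rt : rho <= Num.max sigma rho by rewrite le_max lexx orbT.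
have t0 := le_trans (ltW r0) rt.
by rewrite !lerXn2r ?nnegrE ?exprn_ge0 // ltW.
Qed.
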